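(* Let $d\ge1$ and $n\ge 1$ be integers, let $\mathbf{U}$ be a random vector with values in $[0,1]^d$ and non-atomic law, and let $\varepsilon$ be a real random variable with mean $0$ and finite variance. Consider an admissible partition $\mathcal{C}=(C_1,\dots,C_c)$ of $[0,1]^d$ where each $C_i$ is a lattice. Let $\mathcal{B}$ be an admissible partition obtained by a sequence of refinements by admissible partitions $\mathcal{C}=\mathcal{C}_1\le_{\mathrm{ref.}}\cdots\le_{\mathrm{ref.}}\mathcal{C}_m=\mathcal{B}$, such that for $k=1,\dots,m-1$ the partition $\mathcal{C}_{k+1}$ is obtained from $\mathcal{C}_k$ by splitting one set of $\mathcal{C}_k$, say $C_{i_k,k}$, into $C_{i_k,k}\cap G_k$ and $C_{i_k,k}\cap G_k^c$, where $G_k=\{\mathbf{x}=(x_1,\dots,x_d)\in[0,1]^d: a_k\le x_j\}$ for some $a_k\in[0,1]$ and some $j\in\{1,\dots,d\}$ (which may depend on $k$). If $\mathbf{U}$ is MTP$_2$ on $[0,1]^d$ and $f:[0,1]^d\to[0,1]$ is measurable and non-decreasing in each variable, then $$W_{\mathrm{IE}}^{\mathcal{B}}\le_{\mathrm{cx}}W_{\mathrm{IE}}^{\mathcal{C}}.$$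
   Context: Fix $n$, let $N=\{1,\dots,n\}$ and $\mathfrak{U}=[0,1]^d$. An admissible partition of $\mathfrak{U}$ is a finite sequence $\mathcal{B}=(B_1,\dots,B_b)$ of pairwise disjoint measurable sets with union $\mathfrak{U}$ such that $\mathbb{P}(\mathbf{U}\in B_i)=k_i/n$ with $k_i\in\{1,\dots,n\}$ and $\sum_i k_i=n$. A partition $\mathcal{B}^*=(B_1^*,\dots,B_b^* )$ of $N$ is associated to $\mathcal{B}$ if $|B_i^*|=k_i$ for all $i$; each admissible $\mathcal{B}$ is taken together with an associated $\mathcal{B}^*$, and for $B=B_i\in\mathcal{B}$ one writes $B^*=B_i^*$, so that $\mathbb{P}(\mathbf{U}\in B)=|B^*|/n$. (The laws of the estimators below do not depend on which associated partition is chosen.) $\mathcal{C}\le_{\mathrm{ref.}}\mathcal{B}$ means that every set in $\mathcal{C}$ is a union of sets in $\mathcal{B}$. For $B\in\mathcal{B}$, let $\{V_j^B: j\in B^*, B\in\mathcal{B}\}$ be independent random vectors with $V_j^B$ distributed according to the conditional law of $\mathbf{U}$ given $\mathbf{U}\in B$, and let $\varepsilon_1,\dots,\varepsilon_n$ be independent copies of $\varepsilon$, independent of the $V_j^B$. Define $$W_{\mathrm{IE}}^{\mathcal{B}}=\frac1n\sum_{B\in\mathcal{B}}\sum_{j\in B^*}\bigl(f(V_j^B)+\varepsilon_j\bigr),$$ and define $W_{\mathrm{IE}}^{\mathcal{C}}$ in the same way from $\mathcal{C}$. A subset of $\mathbb{R}^d$ is a lattice if it is closed under componentwise maximum $\vee$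 and componentwise minimum $\wedge$. A random vector $\mathbf{X}$ in $\mathbb{R}^d$ is MTP$_2$ (multivariate totally positive of order 2) if its support is a lattice and its density $f_{\mathbf{X}}$ with respect to some product measure on $\mathbb{R}^d$ satisfies $f_{\mathbf{X}}(\mathbf{s})f_{\mathbf{X}}(\mathbf{t})\le f_{\mathbf{X}}(\mathbf{s}\vee\mathbf{t})f_{\mathbf{X}}(\mathbf{s}\wedge\mathbf{t})$ for all $\mathbf{s},\mathbf{t}\in\mathbb{R}^d$. For integrable real random variables, $Y\le_{\mathrm{cx}}X$ means $\mathbb{E}[\phi(Y)]\le\mathbb{E}[\phi(X)]$ for all convex $\phi:\mathbb{R}\to\mathbb{R}$ (expectations being well defined in $(-\infty,\infty]$). *)

(* Defs.v *)
From HB Require Import structures.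
From mathcomp Require Import all_boot all_order all_algebra.
From mathcomp Require Import all_classical all_reals all_analysis.
Import Order.TTheory GRing.Theory Num.Theory.
Import numFieldNormedType.Exports.
Set Implicit Arguments.
Unset Strict Implicit.
Unset Printing Implicit Defensive.
Local Open Scope classical_set_scope.
Local Open Scope ring_scope.

(* Vectors of R^d are d-tuples, with the product (= Borel) sigma-algebra that
   the library puts on d.-tuple R. *)

Section Vectors.
Variables (R : realType) (d : nat).
Implicit Types (x y : d.-tuple R) (A : set (d.-tuple R)).

Definition cube : set (d.-tuple R) :=
  [set x | forall j, 0 <= tnth x j <= 1].

Definition vmax x y : d.-tuple R :=
  [tuple Num.max (tnth x j) (tnth y j) | j < d].

Definition vmin x y : d.-tuple R :=
  [tuple Num.min (tnth x j) (tnth y j) | j < d].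

Definition lattice_set A :=
  forall x y, A x -> A y -> A (vmax x y) /\ A (vmin x y).

Definition nondecreasing_coord (f : d.-tuple R -> R) :=
  forall (j : 'I_d) x y, cube x -> cube y ->
    (forall i, i != j -> tnth x i = tnth y i) ->
    tnth x j <= tnth y j -> f x <= f y.

End Vectors.

Arguments cube {R d}.

Section Laws.
Variables (R : realType) (d : nat).
Implicit Types (mu : {measure set (d.-tuple R) -> \bar R}).

(* The topological support: the points all of whose neighbourhoods (here, open
   sup-norm balls) have positive measure. *)
Definition msupport mu : set (d.-tuple R) :=
  [set x | forall e : R, 0 < e ->
    (0 < mu [set y : d.-tuple R | forall j, (`|tnth y j - tnth x j| < e)%R])%E].

(* The factors being sigma-finite, the values on measurable boxes determine
   the product measure. *)
Definition is_product_measure mu :=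
  exists nu : 'I_d -> {sigma_finite_measure set R -> \bar R},
    forall A : 'I_d -> set R, (forall j, measurable (A j)) ->
      mu [set x | forall j, A j (tnth x j)] = (\prod_(j < d) nu j (A j))%E.

Definition is_density (mu lambda : {measure set (d.-tuple R) -> \bar R})
    (g : d.-tuple R -> R) :=
  [/\ measurable_fun setT g, (forall x, 0 <= g x) &
      forall A, measurable A -> lambda A = (\int[mu]_(x in A) (g x)%:E)%E].

Definition MTP2 (lambda : {measure set (d.-tuple R) -> \bar R}) :=
  lattice_set (msupport lambda) /\
  exists (mu : {measure set (d.-tuple R) -> \bar R}) (g : d.-tuple R -> R),
    [/\ is_product_measure mu, is_density mu lambda g &
        forall s t, g s * g t <= g (vmax s t) * g (vmin s t)].

End Laws.

Definition non_atomic dT (T : measurableType dT) (R : realType)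
    (mu : {measure set T -> \bar R}) :=
  forall A, measurable A -> (0 < mu A)%E ->
    exists B, [/\ measurable B, B `<=` A & (0 < mu B < mu A)%E].

Definition cond_law dT (T : measurableType dT) (R : realType)
    (mu : {measure set T -> \bar R}) (B A : set T) : \bar R :=
  (mu (A `&` B) / mu B)%E.

Definition mutually_independent dO (Om : measurableType dO) (R : realType)
    (P : probability Om R) (I : finType) (G : I -> set (set Om)) :=
  forall (J : {set I}) (A : I -> set Om),
    (forall i, i \in J -> G i (A i)) ->
    P (\bigcap_(i in [set` J]) A i) = (\prod_(i in J) P (A i))%E.

(* "le_cx P Y Q X" is Y <=_cx X; the convex order only depends on the two laws,
   so Y and X may live on different probability spaces. *)
Definition le_cx (R : realType)
    d1 (O1 : measurableType d1) (P : probability O1 R) (Y : O1 -> R)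
    d2 (O2 : measurableType d2) (Q : probability O2 R) (X : O2 -> R) :=
  [/\ P.-integrable setT (EFin \o Y), Q.-integrable setT (EFin \o X) &
      forall phi : R -> R, convex_function [set: R^o] phi ->
        ('E_P[phi \o Y] <= 'E_Q[phi \o X])%E].

Section Partitions.
Variables (R : realType) (d n : nat).
Variable mu : probability (d.-tuple R) R. (* the law of U *)
Implicit Types (B C : seq (set (d.-tuple R))).

Definition cell B (i : nat) : set (d.-tuple R) := nth set0 B i.

Definition admissible B :=
  [/\ forall i, (i < size B)%N -> measurable (cell B i),
      trivIset `I_(size B) (cell B),
      \bigcup_(i in `I_(size B)) cell B i = cube &
      exists k : 'I_(size B) -> nat,
        (forall i, (1 <= k i <= n)%N /\
                   mu (cell B i) = ((k i)%:R / n%:R)%:E) /\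
        (\sum_(i < size B) k i)%N = n].

(* N = {1, ..., n} is rendered by 'I_n. *)
Definition star (Bs : seq {set 'I_n}) (i : nat) : {set 'I_n} :=
  nth finset.set0 Bs i.

(* The condition |B_i^*| = k_i reads mu B_i = |B_i^*| / n, as mu B_i = k_i / n. *)
Definition associated B (Bs : seq {set 'I_n}) :=
  [/\ size Bs = size B,
      forall i, (i < size B)%N -> mu (cell B i) = (#|star Bs i|%:R / n%:R)%:E,
      forall i j, (i < size B)%N -> (j < size B)%N -> i <> j ->
        star Bs i :&: star Bs j = finset.set0 &
      forall j : 'I_n, exists2 i, (i < size B)%N & j \in star Bs i].

Definition refines C B :=
  forall A, A \in C -> exists2 S : set (set (d.-tuple R)),
    S `<=` [set` B] & A = \bigcup_(D in S) D.

Definition halfcube (j : 'I_d) (a : R) : set (d.-tuple R) :=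
  [set x | cube x /\ a <= tnth x j].

(* The order in which a partition lists its cells is irrelevant, hence the
   equality between sets of cells. *)
Definition splits C C' :=
  exists (i : nat) (j : 'I_d) (a : R),
    [/\ (i < size C)%N, 0 <= a <= 1 &
        [set` C'] = ([set` C] `\ cell C i) `|`
          [set cell C i `&` halfcube j a; cell C i `&` ~` halfcube j a]].

End Partitions.

Section Estimators.
Variables (R : realType) (d n : nat).
Variables (dO : measure_display) (Om : measurableType dO).
Variable P : probability Om R.

(* As B^* partitions N, an index j determines the cell B with j in B^*, so that
   V j stands for V_j^B. *)
Record IE_sample (mu : probability (d.-tuple R) R) (nu : probability R R)
    (B : seq (set (d.-tuple R))) (Bs : seq {set 'I_n})
    (V : 'I_n -> {RV P >-> d.-tuple R}) (E : 'I_n -> {RV P >-> R}) : Prop := {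
  IE_cube : forall j w, cube (V j w) ;
  IE_V_law : forall i j, (i < size B)%N -> j \in star Bs i ->
    forall A, measurable A ->
      distribution P (V j) A = cond_law mu (cell B i) A ;
  IE_E_law : forall j A, measurable A -> distribution P (E j) A = nu A ;
  IE_indep : mutually_independent P (fun s : 'I_n + 'I_n =>
    match s with
    | inl j => preimage_set_system setT (V j) measurable
    | inr j => preimage_set_system setT (E j) measurable
    end)
}.

Definition W_IE (f : d.-tuple R -> R) (Bs : seq {set 'I_n})
    (V : 'I_n -> {RV P >-> d.-tuple R}) (E : 'I_n -> {RV P >-> R}) (w : Om) : R :=
  n%:R^-1 * \sum_(i < size Bs) \sum_(j in star Bs i) (f (V j w) + E j w).

End Estimators.

(* Main.v *)
Require Import Defs.
From HB Require Import structures.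
From mathcomp Require Import all_boot all_order all_algebra.
From mathcomp Require Import all_classical all_reals all_analysis.
From mathcomp Require Import measurable_realfun lra ring.
Import Order.TTheory GRing.Theory Num.Theory.
Import numFieldNormedType.Exports.
Local Open Scope classical_set_scope.
Local Open Scope ring_scope.

Set Implicit Arguments.
Unset Strict Implicit.
Unset Printing Implicit Defensive.

(** The theorem rests on two ideas, one about a single cell and one about sums.

Reading the refinements backwards, it is enough to compare the partition in
which a lattice cell D0 is cut by a coordinate half-space into an upper part D1
and a lower part D2 with the partition that keeps D0. Let p1, p2 and p0 be the
laws of f(U) given D1, D2 and D0. Then p0 = theta p1 + (1 - theta) p2 where
theta is the proportion of points allotted to D1.

First, p1 stochastically dominates p2 ([cell_law_dominates]). This is a
correlation inequality of FKG type. It follows from the four functions theorem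
([four_functions]), proved for product measures on R^d by integrating out one
coordinate at a time; because D0 is a lattice, D1 contains the joins, and
D2 the meets, of a point of D1 with a point of D2.

Secondly, let psi be convex and consider the expectation of psi at the sum of
independent variables, two of them with laws W a = a p1 + (1 - a) p2 and W b,
the others being frozen. Because the increments of psi are nondecreasing and
p1 dominates p2, this expectation has the form A + B (a + b) + C a b with
C nonnegative ([two_draws_supermodular]). So it does not decrease when a and b are
moved towards each other with a + b fixed. Starting from the weights 1 (for the
draws in D1) and 0 (for those in D2) and equalizing them pair by pair, one
reaches the constant weight theta, that is, the unsplit cell
([iter_exp_equalize]).

These computations take place with iterated integrals [iter_exp], in which laws
can be permuted, replaced and integrated in any order. The expectation of a
nonnegative convex function of the estimator is such an integral
([integral_W_IE]), by uniqueness of product measures; the noise is integrated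
last, so the comparison only involves bounded arguments. A general convex
function differs from a nonnegative one by an affine minorant, and the
estimators are integrable with a mean that does not depend on the partition
([W_IE_integrable_mean]), which gives the convex order
([le_cx_of_nonneg]). *)

(** * Product measures on tuples *)

Section TupleProductMeasure.
Context (dT : measure_display) (T : measurableType dT) (R : realType).
Local Open Scope ereal_scope.

Definition box d (A : 'I_d -> set T) : set (d.-tuple T) :=
  [set x | forall j, A j (tnth x j)].

Definition cons_pair d (z : (T * d.-tuple T)%type) : d.+1.-tuple T :=
  [the d.+1.-tuple T of z.1 :: z.2].

Lemma measurable_cons_pair d : measurable_fun setT (@cons_pair d).
Proof. exact: measurable_cons. Qed.

Definition uncons_pair d (x : d.+1.-tuple T) : (T * d.-tuple T)%type :=
  (tnth x ord0, [tuple of behead x]).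

Lemma measurable_uncons_pair d : measurable_fun setT (@uncons_pair d).
Proof.
apply: measurable_fun_pair => /=; first exact: measurable_tnth.
exact: measurable_behead.
Qed.

Lemma cons_pairK d : cancel (@cons_pair d) (@uncons_pair d).
Proof. by case=> a x; congr pair; apply/val_inj. Qed.

(** The product of a law on T and a law on d-tuples, transported to tuples of
length d + 1. Sigma-finiteness is what allows Tonelli's theorem to be applied
again to the next coordinate. *)
Section cons_measure.
Context (d : nat) (m1 : {sigma_finite_measure set T -> \bar R})
  (m2 : {sigma_finite_measure set (d.-tuple T) -> \bar R}).

Definition cons_measure : set (d.+1.-tuple T) -> \bar R :=
  pushforward (m1 \x m2) (@cons_pair d).

Let cons_measure0 : cons_measure set0 = 0.
Proof. by rewrite /cons_measure /pushforward preimage_set0 measure0. Qed.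

Let cons_measure_ge0 A : 0 <= cons_measure A.
Proof. by apply: measure_ge0; exact: measurable_cons_pair. Qed.

Let cons_measure_sigma_additive : semi_sigma_additive cons_measure.
Proof.
by apply: measure_semi_sigma_additive; exact: measurable_cons_pair.
Qed.

HB.instance Definition _ := isMeasure.Build _ _ _ cons_measure
  cons_measure0 cons_measure_ge0 cons_measure_sigma_additive.

Let cons_measure_sigma_finite : sigma_finite setT cons_measure.
Proof.
have /sigma_finiteP[F [TF ndF Foo]] := sigma_finiteT m1.
have /sigma_finiteP[G [TG ndG Goo]] := sigma_finiteT m2.
exists (fun k => @uncons_pair d @^-1` (F k `*` G k)).
  rewrite -preimage_bigcup (_ : \bigcup_i _ = setT) ?preimage_setT//.
  apply/seteqP; split => // -[a x] _.
  have [k _ Fka] : (\bigcup_k F k) a by rewrite -TF.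
  have [l _ Glx] : (\bigcup_l G l) x by rewrite -TG.
  exists (maxn k l) => //; split => /=.
    by move: a Fka; exact/subsetPset/ndF/leq_maxl.
  by move: x Glx; exact/subsetPset/ndG/leq_maxr.
move=> k; have [mF Fk] := Foo k; have [mG Gk] := Goo k; split.
  by rewrite -[X in measurable X]setTI; apply: measurable_uncons_pair => //;
    exact: measurableX.
rewrite /cons_measure /pushforward -comp_preimage.
rewrite (_ : _ \o _ = id); last by rewrite funeqE => z /=; rewrite cons_pairK.
by rewrite preimage_id product_measure1E// lte_mul_pinfty// ge0_fin_numE.
Qed.

HB.instance Definition _ := Measure_isSigmaFinite.Build _ _ _ cons_measure
  cons_measure_sigma_finite.

End cons_measure.

Fixpoint tprod d : ('I_d -> {sigma_finite_measure set T -> \bar R}) ->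
    {sigma_finite_measure set (d.-tuple T) -> \bar R} :=
  match d with
  | 0%N => fun _ => dirac ([tuple] : 0.-tuple T)
  | d'.+1 => fun nu =>
      cons_measure (nu ord0) (tprod (fun i : 'I_d' => nu (lift ord0 i)))
  end.

Lemma measurable_box d (A : 'I_d -> set T) :
  (forall j, measurable (A j)) -> measurable (box A).
Proof.
move=> mA; rewrite (_ : box A = \bigcap_(j in [set: 'I_d]) ((@tnth d T)^~ j @^-1` A j)).
  apply: fin_bigcap_measurable => [|j _]; first exact: finite_finset.
  by rewrite -[X in measurable X]setTI; exact: measurable_tnth.
by apply/seteqP; split => x Ax i; [move=> _; exact: Ax|exact: (Ax i)].
Qed.

Lemma box_consE d (A : 'I_d.+1 -> set T) :
  @cons_pair d @^-1` box A = A ord0 `*` box (fun i => A (lift ord0 i)).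
Proof.
apply/seteqP; split => [[a x] /= Ax|[a x] [/= Aa Ax] j].
  split => /=; first exact: (Ax ord0).
  by move=> j; have := Ax (lift ord0 j); rewrite /= tnthS.
have [j0|->] := unliftP ord0 j; last by [].
by move=> ->; rewrite tnthS; exact: Ax.
Qed.

Lemma tprod_box d (nu : 'I_d -> {sigma_finite_measure set T -> \bar R})
    (A : 'I_d -> set T) : (forall j, measurable (A j)) ->
  tprod nu (box A) = \prod_(j < d) nu j (A j).
Proof.
elim: d nu A => [|d IH] nu A mA.
  by rewrite big_ord0 /= diracE mem_set// => -[].
rewrite big_ord_recl /= /cons_measure /pushforward box_consE.
rewrite product_measure1E//; last exact: measurable_box.
by rewrite IH.
Qed.

(** Tonelli's theorem for the first coordinate, the step of every induction on
the length of tuples. *)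
Lemma integral_tprodS d (nu : 'I_d.+1 -> {sigma_finite_measure set T -> \bar R})
    (f : d.+1.-tuple T -> \bar R) :
  measurable_fun [set: d.+1.-tuple T] f -> (forall x, 0 <= f x) ->
  \int[tprod nu]_x f x =
  \int[nu ord0]_a \int[tprod (fun i => nu (lift ord0 i))]_x f (cons_pair (a, x)).
Proof.
move=> mf f0; rewrite /= ge0_integral_pushforward//; last exact: measurable_cons_pair.
rewrite preimage_setT fubini_tonelli1//=.
by apply: measurableT_comp => //; exact: measurable_cons_pair.
Qed.

Lemma measurable_tupleE d :
  @measurable _ (d.-tuple T) =
  <<s [set B | exists2 A : 'I_d -> set T, (forall j, measurable (A j)) & B = box A] >>.
Proof.
apply/seteqP; split; last first.
  apply: smallest_sub; first exact: sigma_algebra_measurable.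
  by move=> _ [A mA ->]; exact: measurable_box.
apply: smallest_sub; first exact: smallest_sigma_algebra.
move=> B; rewrite -bigcup_seq => -[j _ [Y mY <-]]; apply: sub_sigma_algebra.
exists (fun i => if i == j then Y else setT).
  by move=> i; case: ifP.
apply/seteqP; split => x /=; last first.
  by move=> /(_ j); rewrite eqxx; split.
by move=> [_ Yx] i; case: ifP => // /eqP ->.
Qed.

(** Boxes are stable under intersection and generate the measurable sets, and
exhausting each factor by sets of finite measure exhausts the space by boxes of
finite measure. Hence the values on boxes determine the measure. *)
Lemma tprod_unique d (nu : 'I_d -> {sigma_finite_measure set T -> \bar R})
    (m : {measure set (d.-tuple T) -> \bar R}) :
  (forall A : 'I_d -> set T, (forall j, measurable (A j)) ->
    m (box A) = \prod_(j < d) nu j (A j)) ->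
  forall X, measurable X -> m X = tprod nu X.
Proof.
move=> mbox X mX.
have F_ j : {F : (set T)^nat | [/\ setT = \bigcup_k F k, nondecreasing_seq F &
    forall k, measurable (F k) /\ nu j (F k) < +oo]}.
  by apply: cid; have /sigma_finiteP[F] := sigma_finiteT (nu j); exists F.
pose F j := sval (F_ j).
have FT j : setT = \bigcup_k F j k by have [] := svalP (F_ j).
have Fnd j : nondecreasing_seq (F j) by have [] := svalP (F_ j).
have mF j k : measurable (F j k) by have [_ _ /(_ k)[]] := svalP (F_ j).
have Foo j k : nu j (F j k) < +oo by have [_ _ /(_ k)[]] := svalP (F_ j).
apply: (measure_unique [set B | exists2 A : 'I_d -> set T,
    (forall j, measurable (A j)) & B = box A] (fun k => box (F ^~ k))) => //.
- exact: measurable_tupleE.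
- move=> _ _ [A mA ->] [B mB ->]; exists (fun j => A j `&` B j).
    by move=> j; exact: measurableI.
  apply/seteqP; split => x /= => [[Ax Bx] j|ABx]; first by split; [exact: Ax|exact: Bx].
  by split => j; have [] := ABx j.
- by move=> k; exists (F ^~ k).
- apply/seteqP; split => // x _.
  have kx j : {k | F j k (tnth x j)}.
    by apply: cid; have : setT (tnth x j) by []; rewrite (FT j) => -[k _ ?]; exists k.
  exists (\max_(j < d) sval (kx j))%N => // j.
  have /subsetPset := Fnd j _ _ (@leq_bigmax _ (fun i => sval (kx i)) j).
  by apply; exact: (svalP (kx j)).
- by move=> _ [A mA ->]; rewrite /= mbox//; exact/esym/tprod_box.
- move=> k; rewrite (mbox (F ^~ k))//.
  rewrite -ge0_fin_numE; last by apply: prode_ge0 => j _; exact: measure_ge0.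
  by apply: prode_fin_num => j _; rewrite ge0_fin_numE//.
Qed.

End TupleProductMeasure.

(** * The four functions theorem *)

Section FourFunctions.
Context (R : realType).
Local Open Scope ereal_scope.

(** For real numbers with 0 < c this is (c - a) (c - b) >= 0 rewritten as
c (a + b) <= c c + a b. Infinite values occur because marginals of a density
may be infinite. *)
Lemma lee_add_of_mule (a b c e : \bar R) : 0 <= a -> 0 <= b -> 0 <= e ->
  a <= c -> b <= c -> a * b <= c * e -> a + b <= c + e.
Proof.
case: c => [c| |]; last 2 first.
- by move=> _ _ e0 _ _ _; rewrite addye ?leey// gt_eqF// (lt_le_trans _ e0).
- by move=> a0 _ _ aNy; have := le_trans a0 aNy; rewrite leNgt ltNyr.
case: e => [e| |]; last 2 first.
- by move=> *; rewrite addey ?leey.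
- by move=> _ _ + _ _; rewrite leNgt ltNyr.
case: a => [a| |]; last 2 first.
- by move=> _ _ _; rewrite leye_eq.
- by rewrite leNgt ltNyr.
case: b => [b| |]; last 2 first.
- by move=> _ _ _ _; rewrite leye_eq.
- by move=> _; rewrite leNgt ltNyr.
rewrite -!EFinM -!EFinD !lee_fin => a0 b0 e0 ac bc abce.
have [c0|] := ltP 0%R c; last by move=> c0; lra.
rewrite -(ler_pM2l c0).
have : (0 <= (c - a) * (c - b))%R by rewrite mulr_ge0 ?subr_ge0.
by rewrite !mulrDl !mulrDr; lra.
Qed.

(** Doubling both sides and symmetrizing in (x, y) reduces the inequality
between products of integrals to the pointwise inequality
f1 x f2 y + f1 y f2 x <= f3 x f4 y + f3 y f4 x. When x <= y, both terms on the
left are at most f3 y f4 x, and their product is at most the product of the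
terms on the right, so [lee_add_of_mule] applies. *)
Lemma four_functions_line (nu : {sigma_finite_measure set R -> \bar R})
    (f1 f2 f3 f4 : R -> \bar R) :
  measurable_fun setT f1 -> measurable_fun setT f2 ->
  measurable_fun setT f3 -> measurable_fun setT f4 ->
  (forall x, 0 <= f1 x) -> (forall x, 0 <= f2 x) ->
  (forall x, 0 <= f3 x) -> (forall x, 0 <= f4 x) ->
  (forall x y, f1 x * f2 y <= f3 (Num.max x y) * f4 (Num.min x y)) ->
  (\int[nu]_x f1 x) * (\int[nu]_x f2 x) <= (\int[nu]_x f3 x) * (\int[nu]_x f4 x).
Proof.
move=> mf1 mf2 mf3 mf4 f10 f20 f30 f40 f1234.
have mf12 g h : measurable_fun setT g -> measurable_fun setT h ->
    measurable_fun setT (fun z : R * R => g z.1 * h z.2 : \bar R).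
  move=> mg mh; apply: emeasurable_funM.
    exact: (measurableT_comp mg measurable_fst).
  exact: (measurableT_comp mh measurable_snd).
have mf21 g h : measurable_fun setT g -> measurable_fun setT h ->
    measurable_fun setT (fun z : R * R => g z.2 * h z.1 : \bar R).
  move=> mg mh; apply: emeasurable_funM.
    exact: (measurableT_comp mg measurable_snd).
  exact: (measurableT_comp mh measurable_fst).
have prodE g h : measurable_fun setT g -> measurable_fun setT h ->
    (forall x, 0 <= g x) -> (forall x, 0 <= h x) ->
    (\int[nu]_x g x) * (\int[nu]_x h x) + (\int[nu]_x g x) * (\int[nu]_x h x)
    = \int[nu \x nu]_z (g z.1 * h z.2 + g z.2 * h z.1).
  move=> mg mh g0 h0.
  rewrite ge0_integralD//; [|by move=> *; rewrite mule_ge0|exact: mf12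
    |by move=> *; rewrite mule_ge0|exact: mf21].
  congr (_ + _).
    rewrite fubini_tonelli1; [|exact: mf12|by move=> *; rewrite mule_ge0].
    rewrite /fubini_F/= -ge0_integralZr//; last exact: integral_ge0.
    by apply: eq_integral => x _; rewrite ge0_integralZl.
  rewrite fubini_tonelli2; [|exact: mf21|by move=> *; rewrite mule_ge0].
  rewrite /fubini_G/= -ge0_integralZr//; last exact: integral_ge0.
  by apply: eq_integral => x _; rewrite ge0_integralZl.
suff: (\int[nu]_x f1 x) * (\int[nu]_x f2 x) + (\int[nu]_x f1 x) * (\int[nu]_x f2 x)
   <= (\int[nu]_x f3 x) * (\int[nu]_x f4 x) + (\int[nu]_x f3 x) * (\int[nu]_x f4 x).
  by rewrite !leNgt; apply: contraNN => BA; exact: lteD.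
rewrite !prodE//; apply: ge0_le_integral => //.
- by move=> *; rewrite adde_ge0 ?mule_ge0.
- by apply: emeasurable_funD; [exact: mf12|exact: mf21].
- by apply: emeasurable_funD; [exact: mf12|exact: mf21].
move=> [x y] _ /=; wlog xy : x y / (x <= y)%R.
  by move=> H; have /orP[/H //|/H] := le_total x y; rewrite addeC [leRHS]addeC.
have := f1234 x y; have := f1234 y x; have := f1234 x x; have := f1234 y y.
rewrite !maxxx !minxx (max_r xy) (min_l xy) (max_l xy) (min_r xy).
move=> fyy fxx fyx fxy; rewrite [leRHS]addeC.
apply: lee_add_of_mule; rewrite ?mule_ge0//.
rewrite muleACA [f2 y * _]muleC muleACA.
rewrite [leRHS]muleACA [f3 y * _]muleC [leRHS]muleACA.
by apply: lee_pmul; rewrite ?mule_ge0.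
Qed.

Lemma vmax_cons d (a b : R) (x y : d.-tuple R) :
  vmax (cons_pair (a, x)) (cons_pair (b, y)) = cons_pair (Num.max a b, vmax x y).
Proof.
apply: eq_from_tnth => j; rewrite tnth_mktuple.
by have [i ->|->] := unliftP ord0 j; rewrite ?tnthS ?tnth_mktuple.
Qed.

Lemma vmin_cons d (a b : R) (x y : d.-tuple R) :
  vmin (cons_pair (a, x)) (cons_pair (b, y)) = cons_pair (Num.min a b, vmin x y).
Proof.
apply: eq_from_tnth => j; rewrite tnth_mktuple.
by have [i ->|->] := unliftP ord0 j; rewrite ?tnthS ?tnth_mktuple.
Qed.

(** Induction on the dimension: for fixed first coordinates, the induction
hypothesis says that the marginals in the first coordinate satisfy the
hypothesis of the one-dimensional case. *)
Lemma four_functions d (nu : 'I_d -> {sigma_finite_measure set R -> \bar R})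
    (f1 f2 f3 f4 : d.-tuple R -> \bar R) :
  measurable_fun [set: d.-tuple R] f1 -> measurable_fun [set: d.-tuple R] f2 ->
  measurable_fun [set: d.-tuple R] f3 -> measurable_fun [set: d.-tuple R] f4 ->
  (forall x, 0 <= f1 x) -> (forall x, 0 <= f2 x) ->
  (forall x, 0 <= f3 x) -> (forall x, 0 <= f4 x) ->
  (forall x y, f1 x * f2 y <= f3 (vmax x y) * f4 (vmin x y)) ->
  (\int[tprod nu]_x f1 x) * (\int[tprod nu]_x f2 x) <=
  (\int[tprod nu]_x f3 x) * (\int[tprod nu]_x f4 x).
Proof.
elim: d nu f1 f2 f3 f4 => [|d IH] nu f1 f2 f3 f4 mf1 mf2 mf3 mf4 f10 f20 f30 f40 f1234.
  rewrite /= !integral_dirac// !diracT !mul1e.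
  by have := f1234 [tuple] [tuple]; rewrite [vmax _ _]tuple0 [vmin _ _]tuple0.
have mcons g : measurable_fun [set: d.+1.-tuple R] g ->
    measurable_fun setT (fun z : (R * d.-tuple R)%type => g (cons_pair z) : \bar R).
  by move=> mg; exact: (measurableT_comp mg (@measurable_cons_pair _ _ _)).
have msec g a : measurable_fun [set: d.+1.-tuple R] g ->
    measurable_fun [set: d.-tuple R] (fun x => g (cons_pair (a, x)) : \bar R).
  by move=> /mcons mg; exact: (measurableT_comp mg (pair1_measurable a)).
have mmarg g : measurable_fun [set: d.+1.-tuple R] g -> (forall x, 0 <= g x) ->
    measurable_fun setT (fun a => \int[tprod (fun i => nu (lift ord0 i))]_x
      g (cons_pair (a, x)) : \bar R).
  move=> mg g0.
  apply: (measurable_fun_fubini_tonelli_F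
    (fun z : (R * d.-tuple R)%type => g (cons_pair z))) => //; exact: mcons.
rewrite !integral_tprodS//; apply: four_functions_line; try exact: mmarg;
  try by move=> a; exact: integral_ge0.
move=> a b; apply: IH; try exact: msec; move=> //.
by move=> x y; rewrite -vmax_cons -vmin_cons.
Qed.

End FourFunctions.

(** * Densities and correlation under MTP2 *)

Section Density.
Context dT (T : measurableType dT) (R : realType).
Local Open Scope ereal_scope.
Variables (mu lam : {measure set T -> \bar R}) (g : T -> R).
Hypothesis mg : measurable_fun [set: T] g.
Hypothesis g0 : forall x, (0 <= g x)%R.
Hypothesis lamE : forall A, measurable A -> lam A = \int[mu]_(x in A) (g x)%:E.

Import HBNNSimple.

Let integral_density_nnsfun (h : {nnsfun T >-> R}) :
  \int[lam]_x (h x)%:E = \int[mu]_x ((h x)%:E * (g x)%:E).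
Proof.
under [LHS]eq_integral do rewrite fimfunE -fsumEFin//.
rewrite [LHS]ge0_integral_fsum//; last 2 first.
  - by move=> r; exact/measurable_EFinP/measurableT_comp.
  - by move=> r x _; rewrite EFinM nnfun_muleindic_ge0.
under [RHS]eq_integral.
  move=> x xD; rewrite fimfunE -fsumEFin// ge0_mule_fsuml; last first.
    by move=> r; rewrite EFinM nnfun_muleindic_ge0.
  over.
rewrite [RHS]ge0_integral_fsum//; last 2 first.
  - move=> r; apply: emeasurable_funM; last exact/measurable_EFinP.
    exact/measurable_EFinP/measurableT_comp.
  - by move=> r x _; apply: mule_ge0; [rewrite EFinM nnfun_muleindic_ge0|rewrite lee_fin].
apply: eq_fsbigr => r _.
have [r0|r0] := ltP r 0%R.
  rewrite !integral0_eq// => x _; rewrite preimage_nnfun0// indic0 mulr0 ?mul0e//.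
under [RHS]eq_integral do rewrite EFinM -muleA.
rewrite integralZl_indic_nnsfun// integral_indic// setIT lamE//.
rewrite ge0_integralZl//; last 2 first.
  - apply: emeasurable_funM; last exact/measurable_EFinP.
    exact/measurable_EFinP/measurable_indic.
  - by move=> x _; rewrite mule_ge0 ?lee_fin.
congr (_ * _); rewrite [LHS]integral_mkcond; apply: eq_integral => x _.
by rewrite patchE indicE; case: ifPn => _; rewrite ?mul1e ?mul0e.
Qed.

(** The formula holds for nonnegative simple functions by linearity, hence for
their monotone limits. *)
Lemma integral_density (f : T -> \bar R) : measurable_fun [set: T] f ->
  (forall x, 0 <= f x) -> \int[lam]_x f x = \int[mu]_x (f x * (g x)%:E).
Proof.
move=> mf f0; pose f_ := nnsfun_approx measurableT mf.
transitivity (limn (fun n => \int[lam]_x (f_ n x)%:E)).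
  rewrite -monotone_convergence//=.
  - apply: eq_integral => x _; apply/esym/cvg_lim => //=.
    exact: cvg_nnsfun_approx.
  - by move=> n; apply: measurableT_comp => //; exact: measurable_funTS.
  - by move=> n x _; rewrite lee_fin.
  - by move=> x _ a b ab; rewrite lee_fin//; exact/lefP/nd_nnsfun_approx.
under eq_fun do rewrite integral_density_nnsfun.
rewrite -monotone_convergence//=.
- apply: eq_integral => x _; apply/cvg_lim => //.
  by apply: cvgeZr => //; exact: cvg_nnsfun_approx.
- move=> n; apply: emeasurable_funM; last exact/measurable_EFinP.
  exact/measurable_EFinP.
- by move=> n x _; rewrite mule_ge0 ?lee_fin.
- move=> x _ a b ab; rewrite lee_wpmul2r ?lee_fin//.
  exact/lefP/nd_nnsfun_approx.
Qed.

End Density.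

Section Dominance.
Context (R : realType) (d : nat).
Local Open Scope ereal_scope.
Variable lam : {measure set (d.-tuple R) -> \bar R}.
Hypothesis MTP2_lam : MTP2 lam.

(** The four functions are H g and g on D2 and D1 respectively, then H g and g
on D1 and D2, where g is the density: the pointwise inequality combines the
multivariate total positivity of g with the monotonicity of H along joins. *)
Lemma MTP2_correlation (D1 D2 : set (d.-tuple R)) (H : d.-tuple R -> \bar R) :
  measurable D1 -> measurable D2 ->
  measurable_fun [set: d.-tuple R] H -> (forall x, 0 <= H x) ->
  (forall x y, D2 x -> D1 y ->
    [/\ D1 (vmax x y), D2 (vmin x y) & H x <= H (vmax x y)]) ->
  (\int[lam]_(x in D2) H x) * lam D1 <= (\int[lam]_(x in D1) H x) * lam D2.
Proof.
move=> mD1 mD2 mH H0 HD.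
have [_ [mu [g [[nu munu] [mg g0 lamE] gg]]]] := MTP2_lam.
have mucE (F : d.-tuple R -> \bar R) : \int[mu]_x F x = \int[tprod nu]_x F x.
  apply: eq_measure_integral => A mA _; apply: tprod_unique => //.
have mgE : measurable_fun [set: d.-tuple R] (EFin \o g) by exact/measurable_EFinP.
have restr D F : measurable D -> measurable_fun [set: d.-tuple R] F ->
    (forall x, 0 <= F x) ->
    [/\ measurable_fun [set: d.-tuple R] (fun x => (F \_ D) x * (g x)%:E),
        forall x, 0 <= (F \_ D) x * (g x)%:E &
        \int[lam]_(x in D) F x = \int[tprod nu]_x ((F \_ D) x * (g x)%:E)].
  move=> mD mF F0.
  have mFD : measurable_fun [set: d.-tuple R] (F \_ D).
    by apply/(measurable_restrictT _ mD); exact: measurable_funTS.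
  have FD0 x : 0 <= (F \_ D) x by rewrite patchE; case: ifP.
  split.
  - exact: emeasurable_funM.
  - by move=> x; rewrite mule_ge0 ?lee_fin.
  - by rewrite integral_mkcond -mucE; exact: integral_density.
have lamcst D : measurable D -> lam D = \int[lam]_(x in D) cst 1 x.
  by move=> mD; rewrite integral_cst// mul1e.
rewrite (lamcst _ mD1) (lamcst _ mD2).
have m1 : measurable_fun [set: d.-tuple R] (cst 1 : d.-tuple R -> \bar R) by [].
have p1 (x : d.-tuple R) : 0 <= (cst 1 x : \bar R) by rewrite /= lee_fin.
have [? ? ->] := restr D2 _ mD2 mH H0; have [? ? ->] := restr D1 _ mD1 m1 p1.
have [? p3 ->] := restr D1 _ mD1 mH H0; have [? p4 ->] := restr D2 _ mD2 m1 p1.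
apply: four_functions => // x y.
have := mule_ge0 (p3 (vmax x y)) (p4 (vmin x y)).
rewrite !patchE (_ : point = 0)// => p34.
case: ifPn => [/set_mem D2x|_]; last by rewrite !mul0e.
case: ifPn => [/set_mem D1y|_]; last by rewrite mul0e mule0.
have [D1xy D2xy Hxy] := HD x y D2x D1y.
rewrite !mem_set// !mul1e -!muleA; apply: lee_pmul; rewrite ?mule_ge0 ?lee_fin//.
Qed.

End Dominance.

Section Coordinatewise.
Context (R : realType) (d : nat).
Implicit Types x y : d.-tuple R.

(** Passing from x to y by changing one coordinate at a time, all the
intermediate points stay in the cube. *)
Lemma nondecreasing_coord_le (f : d.-tuple R -> R) x y :
  nondecreasing_coord f -> cube x -> cube y ->
  (forall j, tnth x j <= tnth y j) -> f x <= f y.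
Proof.
move=> fnd cx cy xy.
pose z k : d.-tuple R := [tuple if (j < k)%N then tnth y j else tnth x j | j < d].
have cz k : cube (z k).
  by move=> j; rewrite tnth_mktuple; case: ifP => _; [exact: cy|exact: cx].
have zS k : f (z k) <= f (z k.+1).
  have [kd|dk] := ltnP k d.
    apply: (fnd (Ordinal kd)) => // [i|]; rewrite !tnth_mktuple /=.
      move=> ik; rewrite ltnS [(i <= k)%N]leq_eqVlt.
      by rewrite (_ : (i == k :> nat) = false)//; exact/negbTE.
    by rewrite ltnn ltnSn.
  rewrite (_ : z k = z k.+1)//; apply: eq_from_tnth => j; rewrite !tnth_mktuple.
  by rewrite (leq_trans (ltn_ord j) dk) (leq_trans (ltn_ord j) (leqW dk)).
have -> : x = z 0%N by apply: eq_from_tnth => j; rewrite tnth_mktuple.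
have -> : y = z d by apply: eq_from_tnth => j; rewrite tnth_mktuple ltn_ord.
have: forall k, f (z 0%N) <= f (z k) by elim=> // k IH; exact: le_trans IH (zS k).
exact.
Qed.

Lemma vmax_ger x y j : tnth x j <= tnth (vmax x y) j.
Proof. by rewrite tnth_mktuple le_max lexx. Qed.

(** The j-th coordinate of a join or of a meet is the j-th coordinate of one of
the two points, so both sides of the cut are preserved. *)
Lemma lattice_split (A : set (d.-tuple R)) j a :
  A `<=` cube -> lattice_set A ->
  lattice_set (A `&` halfcube j a) /\ lattice_set (A `&` ~` halfcube j a).
Proof.
move=> Ac lA; split => x y [Ax hx] [Ay hy].
  have [? ?] := lA x y Ax Ay; move: hx hy => [_ hx] [_ hy].
  split; split => //; split; try exact: Ac.
    by rewrite tnth_mktuple le_max hx.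
  by rewrite tnth_mktuple le_min hx.
have xa : tnth x j < a.
  by rewrite ltNge; apply/negP => ?; apply: hx; split; first exact: Ac.
have ya : tnth y j < a.
  by rewrite ltNge; apply/negP => ?; apply: hy; split; first exact: Ac.
have [? ?] := lA x y Ax Ay.
split; split => // -[_]; rewrite tnth_mktuple leNgt.
  by rewrite gt_max xa ya.
by rewrite gt_min xa.
Qed.

(** Stochastic domination between the two sides of the cut, before dividing by
their probabilities. A point of the lower side joined with a point of the upper
side is in the upper side, and their meet is in the lower side. *)
Lemma MTP2_dominance (lam : {measure set (d.-tuple R) -> \bar R})
    (f : d.-tuple R -> R) (h : R -> R) (D : set (d.-tuple R)) j a :
  MTP2 lam -> measurable_fun [set: d.-tuple R] f -> nondecreasing_coord f ->
  (forall x, cube x -> 0 <= f x <= 1) ->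
  measurable D -> D `<=` cube -> lattice_set D -> measurable (halfcube j a) ->
  measurable_fun setT h -> (forall t, 0 <= h t) ->
  (forall s t, 0 <= s -> s <= t -> t <= 1 -> h s <= h t) ->
  ((\int[lam]_(x in D `&` ~` halfcube j a) (h (f x))%:E) * lam (D `&` halfcube j a) <=
   (\int[lam]_(x in D `&` halfcube j a) (h (f x))%:E) * lam (D `&` ~` halfcube j a))%E.
Proof.
move=> lamM mf fnd f01 mD Dc lD mG mh h0 hnd.
apply: MTP2_correlation => //.
- exact: measurableI.
- by apply: measurableI => //; exact: measurableC.
- by apply/measurable_EFinP; exact: measurableT_comp.
- by move=> x; rewrite lee_fin.
move=> x y [Dx nGx] [Dy [cy Gy]].
have [Dxy Dxy'] := lD x y Dx Dy.
have xa : tnth x j < a.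
  by rewrite ltNge; apply/negP => ?; apply: nGx; split; first exact: Dc.
split.
- split => //; split; first exact: Dc.
  by rewrite tnth_mktuple le_max Gy orbT.
- by split => // -[_]; rewrite tnth_mktuple le_min => /andP[]; rewrite leNgt xa.
- have cx := Dc _ Dx; have cxy := Dc _ Dxy.
  rewrite lee_fin; apply: hnd.
  + by have /andP[] := f01 _ cx.
  + by apply: nondecreasing_coord_le => // i; exact: vmax_ger.
  + by have /andP[] := f01 _ cxy.
Qed.

End Coordinatewise.

(** * Iterated expectations of sums *)

Section IteratedExpectation.
Context (R : realType).
Local Open Scope ereal_scope.
Implicit Types (h : R -> \bar R) (p q : probability R R) (l : seq (probability R R)).

(** The expectation of h at y plus a sum of independent variables with laws in l,
as nested integrals rather than as one integral over a product space, so that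
laws can be moved and replaced one at a time. *)
Fixpoint iter_exp h l (y : R) : \bar R :=
  if l is p :: l' then \int[p]_x iter_exp h l' (y + x)%R else h y.

Lemma iter_exp_ge0 h l y : (forall x, 0 <= h x) -> 0 <= iter_exp h l y.
Proof.
by move=> h0; elim: l y => [|p l IH] y //=; exact: integral_ge0.
Qed.

Lemma measurable_fun_addr2 h : measurable_fun setT h ->
  measurable_fun setT (fun z : R * R => h (z.1 + z.2)%R).
Proof.
move=> mh; apply: (measurableT_comp mh).
by apply: measurable_funD; [exact: measurable_fst|exact: measurable_snd].
Qed.

Lemma measurable_iter_exp h l : measurable_fun setT h -> (forall x, 0 <= h x) ->
  measurable_fun setT (iter_exp h l).
Proof.
move=> mh h0; elim: l => [|p l IH] //=.
apply: (measurable_fun_fubini_tonelli_F (fun z : R * R => iter_exp h l (z.1 + z.2)%R)).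
  exact: measurable_fun_addr2.
by move=> z; exact: iter_exp_ge0.
Qed.

Lemma measurable_shift h (y : R) : measurable_fun setT h ->
  measurable_fun setT (fun x : R => h (y + x)%R).
Proof. by move=> mh; apply: (measurableT_comp mh); exact: measurable_funD. Qed.

Lemma iter_exp_cat h l1 l2 y :
  iter_exp h (l1 ++ l2) y = iter_exp (iter_exp h l2) l1 y.
Proof. by elim: l1 y => [|p l1 IH] y //=; apply: eq_integral => x _. Qed.

Lemma le_iter_exp h h' l y :
  measurable_fun setT h -> (forall x, 0 <= h x) ->
  measurable_fun setT h' -> (forall x, 0 <= h' x) ->
  (forall x, h x <= h' x) -> iter_exp h l y <= iter_exp h' l y.
Proof.
move=> mh h0 mh' h0' hh'; elim: l y => [|p l IH] y //=.
apply: ge0_le_integral => //.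
- by move=> x _; exact: iter_exp_ge0.
- by apply: measurable_shift; exact: measurable_iter_exp.
- by apply: measurable_shift; exact: measurable_iter_exp.
Qed.

(** Tonelli's theorem exchanges p with the laws of l1 one after the other. *)
Lemma iter_exp_cons_cat h p l1 l2 y : measurable_fun setT h -> (forall x, 0 <= h x) ->
  iter_exp h (p :: l1 ++ l2) y = iter_exp h (l1 ++ p :: l2) y.
Proof.
move=> mh h0; elim: l1 y => [//|q l1 IH] y /=.
under [RHS]eq_integral do rewrite -IH.
rewrite /= (fubini_tonelli (fun z : R * R => iter_exp h (l1 ++ l2) (y + z.1 + z.2)%R)).
- by apply: eq_integral => x _; apply: eq_integral => x' _ /=; rewrite addrAC.
- apply: (measurableT_comp (measurable_iter_exp _ mh h0)).
  apply: measurable_funD; last exact: measurable_snd.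
  by apply: measurable_funD => //; exact: measurable_fst.
- by move=> z; exact: iter_exp_ge0.
Qed.

Lemma iter_exp_catCA h l1 l2 l3 y : measurable_fun setT h -> (forall x, 0 <= h x) ->
  iter_exp h (l1 ++ l2 ++ l3) y = iter_exp h (l2 ++ l1 ++ l3) y.
Proof.
move=> mh h0; elim: l1 y => [//|p l1 IH] y.
rewrite [RHS](_ : _ = iter_exp h (p :: l2 ++ l1 ++ l3) y); last first.
  by rewrite iter_exp_cons_cat.
by rewrite /=; apply: eq_integral => x _; exact: IH.
Qed.

Lemma iter_exp_perm (I : eqType) (F : I -> probability R R) h (s1 s2 : seq I) y :
  measurable_fun setT h -> (forall x, 0 <= h x) -> perm_eq s1 s2 ->
  iter_exp h (map F s1) y = iter_exp h (map F s2) y.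
Proof.
move=> mh h0 s12; apply/esym.
pose P s := iter_exp h (map F s) y = iter_exp h (map F s1) y.
apply: (catCA_perm_ind (P := P) _ s12); last by [].
by move=> r1 r2 r3; rewrite /P !map_cat => <-; exact: iter_exp_catCA.
Qed.

Lemma eq_iter_exp (I : eqType) (F G : I -> probability R R) h (s : seq I) y :
  (forall i, i \in s -> forall A, measurable A -> F i A = G i A) ->
  iter_exp h (map F s) y = iter_exp h (map G s) y.
Proof.
elim: s y => [//|i s IH] y FG /=.
rewrite (eq_measure_integral (G i)).
  by apply: eq_integral => x _; apply: IH => j js; apply: FG; rewrite inE js orbT.
by move=> A mA _; apply: FG => //; rewrite inE eqxx.
Qed.

(** The link with product measures; p0 is only the default value of [nth]. *)
Lemma integral_tprod_iter_exp h (p0 : probability R R) l y :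
  measurable_fun setT h -> (forall x, 0 <= h x) ->
  \int[tprod (fun i : 'I_(size l) =>
         nth p0 l i : {sigma_finite_measure set R -> \bar R})]_x
    h (y + \sum_(i < size l) tnth x i)%R = iter_exp h l y.
Proof.
move=> mh h0; elim: l y => [|p l IH] y.
  rewrite /= integral_dirac//; first by rewrite diracT mul1e big_ord0 addr0.
  apply: measurableT_comp => //; apply: measurable_funD => //.
  by apply: measurable_sum => i; exact: measurable_tnth.
rewrite integral_tprodS//; last first.
  apply: measurableT_comp => //; apply: measurable_funD => //.
  by apply: measurable_sum => i; exact: measurable_tnth.
rewrite /=; apply: eq_integral => a _; rewrite -IH; apply: eq_integral => x _.
rewrite big_ord_recl addrA /=; congr (h (_ + _ + _)%R).
by apply: eq_bigr => i _; rewrite tnthS.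
Qed.

End IteratedExpectation.

(** * Convex functions on the line *)

Section ConvexReal.
Context (R : realType).
Implicit Types (phi : R -> R).

(** Convexity with real weights, the form in which linear arithmetic applies. *)
Definition convex_real phi := forall t x y : R, 0 <= t <= 1 ->
  phi (t * x + (1 - t) * y) <= t * phi x + (1 - t) * phi y.

Lemma convex_function_real phi :
  convex_function [set: R^o] phi -> convex_real phi.
Proof.
move=> cphi t x y /andP[t0 t1].
have := cphi (Itv01 t0 t1) x y; rewrite !inE => /(_ I I).
by rewrite !convRE.
Qed.

Lemma convex_real_chord phi (a x b : R) : convex_real phi -> a <= x -> x <= b ->
  (b - a) * phi x <= (b - x) * phi a + (x - a) * phi b.
Proof.
move=> cphi ax xb; have [ab|ab] := ltP 0 (b - a); last first.
  have -> : x = a by lra.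
  have -> : b = a by lra.
  by rewrite !subrr !mul0r addr0.
have t01 : 0 <= (b - x) / (b - a) <= 1.
  by apply/andP; split; [apply: divr_ge0; lra|rewrite ler_pdivrMr//; lra].
have := cphi ((b - x) / (b - a)) a b t01.
have ab0 : b - a != 0 by rewrite gt_eqF.
have -> : (b - x) / (b - a) * a + (1 - (b - x) / (b - a)) * b = x by field.
rewrite -(ler_pM2l ab) => /le_trans; apply.
by rewrite le_eqVlt; apply/orP; left; apply/eqP; field.
Qed.

(** Both u + s and v lie between u and v + s, with complementary weights. *)
Lemma convex_real_increments phi (u v s : R) : convex_real phi -> 0 <= s -> u <= v ->
  phi (u + s) + phi v <= phi u + phi (v + s).
Proof.
move=> cphi s0 uv; have [L0|L0] := ltP 0 (v + s - u); last first.
  have -> : v = u by lra.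
  have -> : s = 0 by lra.
  by rewrite addr0.
have h1 : (v + s - u) * phi (u + s) <= (v - u) * phi u + s * phi (v + s).
  have := @convex_real_chord phi u (u + s) (v + s) cphi (ltac:(lra)) (ltac:(lra)).
  have -> : v + s - (u + s) = v - u by ring.
  by have -> : u + s - u = s by ring.
have h2 : (v + s - u) * phi v <= s * phi u + (v - u) * phi (v + s).
  have := @convex_real_chord phi u v (v + s) cphi (ltac:(lra)) (ltac:(lra)).
  by have -> : v + s - v = s by ring.
by rewrite -(ler_pM2l L0) !mulrDr; lra.
Qed.

Lemma convex_real_le_max phi (a x b : R) : convex_real phi -> a <= x -> x <= b ->
  phi x <= Num.max (phi a) (phi b).
Proof.
move=> cphi ax xb; have := convex_real_chord cphi ax xb.
set M := Num.max _ _.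
have aM : phi a <= M by rewrite le_max lexx.
have bM : phi b <= M by rewrite le_max lexx orbT.
have [ab|ab] := ltP 0 (b - a); last first.
  by move=> _; have -> : x = a by lra.
move=> h; rewrite -(ler_pM2l ab); apply: le_trans h _.
have : (b - x) * phi a <= (b - x) * M by rewrite ler_wpM2l ?subr_ge0.
have : (x - a) * phi b <= (x - a) * M by rewrite ler_wpM2l ?subr_ge0.
by lra.
Qed.

(** Sublevel sets of a convex function are intervals. *)
Lemma measurable_convex_real phi : convex_real phi -> measurable_fun setT phi.
Proof.
move=> cphi; apply: (measurability (@RGenInftyO.G R)) => [|/= _ [_] [r] -> <-].
  exact: RGenInftyO.measurableE.
apply: measurableI => //; apply: is_interval_measurable => s t/=.
rewrite !in_itv/= => fs ft u /andP[su ut].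
by rewrite in_itv/= (le_lt_trans (convex_real_le_max cphi su ut))// gt_max fs.
Qed.

Lemma convex_real_affine phi (a b : R) : convex_real phi ->
  convex_real (fun x => phi (a * (x + b))).
Proof.
move=> cphi t x y t01; rewrite (_ : a * _ = t * (a * (x + b)) + (1 - t) * (a * (y + b))).
  exact: cphi.
by ring.
Qed.

Lemma convex_real_subaffine phi (a b : R) : convex_real phi ->
  convex_real (fun x => phi x - (a * x + b)).
Proof. by move=> cphi t x y t01; have := cphi t x y t01; lra. Qed.

(** The slope a is the supremum of the slopes of chords ending at 0, which are
bounded by those of the chords starting at 0. *)
Lemma convex_real_minorant phi : convex_real phi ->
  exists a b, forall x, a * x + b <= phi x.
Proof.
move=> cphi.
pose S := [set s | exists2 t, 0 < t & s = (phi 0 - phi (- t)) / t].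
have key t u : 0 < t -> 0 < u -> (phi 0 - phi (- t)) / t <= (phi u - phi 0) / u.
  move=> t0 u0; have := @convex_real_chord phi (- t) 0 u cphi.
  rewrite !opprK !subr0 add0r => /(_ _ _) h.
  have := h (ltac:(lra)) (ltac:(lra)).
  rewrite ler_pdivrMr// mulrAC ler_pdivlMr//; lra.
have supS : has_sup S.
  split; first by exists ((phi 0 - phi (- 1)) / 1); exists 1.
  exists ((phi 1 - phi 0) / 1) => _ [t t0 ->]; exact: key.
exists (sup S), (phi 0) => x.
have [x0|x0|->] := ltgtP x 0; last by rewrite mulr0 add0r.
- have : (phi 0 - phi x) / - x <= sup S.
    by apply: ub_le_sup; [exact: supS.2|exists (- x); rewrite ?opprK// oppr_gt0].
  rewrite ler_pdivrMr ?oppr_gt0//; lra.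
- have : sup S <= (phi x - phi 0) / x.
    by apply: ge_sup; [exact: supS.1|move=> _ [t t0 ->]; exact: key].
  rewrite ler_pdivlMr//; lra.
Qed.

End ConvexReal.

(** * Mixtures and stochastic domination *)

Section Mixture.
Context dT (T : measurableType dT) (R : realType).
Local Open Scope ereal_scope.
Variables (t : {i01 R}) (p q : probability T R).

Let t_ge0 : (0 <= t%:num)%R. Proof. by []. Qed.
Let onemt_ge0 : (0 <= 1 - t%:num)%R. Proof. by rewrite subr_ge0. Qed.

Definition mixture : set T -> \bar R :=
  measure_add (mscale (NngNum t_ge0) p) (mscale (NngNum onemt_ge0) q).

HB.instance Definition _ := Measure.on mixture.

Let mixture_setT : mixture setT = 1.
Proof.
rewrite /mixture measure_addE.
transitivity (t%:num%:E * p setT + (1 - t%:num)%:E * q setT) => //.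
rewrite !probability_setT !mule1 -EFinD.
by rewrite addrC subrK.
Qed.

HB.instance Definition _ := Measure_isProbability.Build _ _ _ mixture mixture_setT.

Lemma mixtureE A : mixture A = t%:num%:E * p A + (1 - t%:num)%:E * q A.
Proof. by rewrite /mixture measure_addE. Qed.

Lemma integral_mixture (h : T -> \bar R) :
  measurable_fun setT h -> (forall x, 0 <= h x) ->
  \int[mixture]_x h x = t%:num%:E * \int[p]_x h x + (1 - t%:num)%:E * \int[q]_x h x.
Proof.
by move=> mh h0; rewrite ge0_integral_measure_add// !ge0_integral_mscale.
Qed.

End Mixture.

Section MixtureExchange.
Context (R : realType).
Local Open Scope ereal_scope.
Implicit Types (p q : probability R R).

Definition carried01 p := p (~` `[0%R, 1%R]) = 0.

(** The usual stochastic order for laws carried by [0, 1]: monotonicity of the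
test functions is required there only. *)
Definition dominates p q := forall h : R -> R,
  measurable_fun setT h -> (forall x, 0 <= h x)%R ->
  (forall s t, 0 <= s -> s <= t -> t <= 1 -> h s <= h t)%R ->
  \int[q]_x (h x)%:E <= \int[p]_x (h x)%:E.

Lemma integral_carried01 p (h : R -> \bar R) : carried01 p ->
  measurable_fun setT h -> (forall x, 0 <= h x) ->
  \int[p]_x h x = \int[p]_(x in `[0%R, 1%R]) h x.
Proof.
move=> p01 mh h0; rewrite -(setUv `[0%R, 1%R]%classic) ge0_integral_setU//=; last 3 first.
- exact: measurableC.
- by rewrite setUv.
- by rewrite disj_set2E setICr.
rewrite [X in _ + X](_ : _ = 0) ?adde0//.
by apply: null_set_integral => //; [exact: measurableC|exact: measurable_funTS].
Qed.

Lemma carried01_mass p : carried01 p -> p `[0%R, 1%R]%classic = 1.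
Proof.
move=> p01; have := probability_setT p; rewrite -(setUv `[0%R, 1%R]%classic).
rewrite measureU//=; [|exact: measurableC|by rewrite setICr].
by rewrite (_ : p (~` _) = 0)// adde0.
Qed.

Lemma integral_carried01_fin p (h : R -> \bar R) (K : R) : carried01 p ->
  measurable_fun setT h -> (forall x, 0 <= h x) ->
  (forall x, (0 <= x <= 1)%R -> h x <= K%:E) ->
  0 <= \int[p]_x h x <= K%:E.
Proof.
move=> p01 mh h0 hK; apply/andP; split; first exact: integral_ge0.
rewrite integral_carried01//.
apply: (@le_trans _ _ (\int[p]_(x in `[0%R, 1%R]) cst K%:E x)).
  by apply: ge0_le_integral => //=; exact: measurable_funTS.
by rewrite integral_cst//= (carried01_mass p01) mule1.
Qed.

(** Domination tested on the function P - Q, which is nondecreasing on [0, 1]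
without being nonnegative: adding the bound K repairs this, and the statement is
written without subtraction. *)
Lemma dominates_difference p q (P Q : R -> \bar R) (K : R) :
  carried01 p -> carried01 q -> dominates p q ->
  measurable_fun setT P -> measurable_fun setT Q ->
  (forall x, 0 <= P x) -> (forall x, 0 <= Q x) ->
  (forall x, (0 <= x <= 1)%R -> P x <= K%:E) ->
  (forall x, (0 <= x <= 1)%R -> Q x <= K%:E) ->
  (forall s t, (0 <= s)%R -> (s <= t)%R -> (t <= 1)%R ->
    P s + Q t <= P t + Q s) ->
  \int[q]_x P x + \int[p]_x Q x <= \int[p]_x P x + \int[q]_x Q x.
Proof.
move=> p01 q01 pq mP mQ P0 Q0 PK QK PQ.
pose D : set R := `[0%R, 1%R]%classic.
have mD : measurable D by exact: measurable_itv.
have DE x : D x -> (0 <= x <= 1)%R by rewrite /D/= in_itv.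
have finP x : D x -> P x \is a fin_num.
  by move=> /DE Dx; rewrite ge0_fin_numE// (le_lt_trans (PK x Dx)) ?ltry.
have finQ x : D x -> Q x \is a fin_num.
  by move=> /DE Dx; rewrite ge0_fin_numE// (le_lt_trans (QK x Dx)) ?ltry.
pose h := (fun x => fine (P x) - fine (Q x) + K)%R \_ D.
have hE x : D x -> ((h x)%:E + Q x = P x + K%:E).
  move=> Dx; rewrite /h patchE mem_set//.
  by rewrite -{2}(fineK (finP x Dx)) -{2}(fineK (finQ x Dx)) -!EFinD; congr EFin; ring.
have h0 x : (0 <= h x)%R.
  rewrite /h patchE; case: ifPn => // /set_mem Dx.
  have := QK x (DE x Dx); have := P0 x.
  by rewrite -(fineK (finP x Dx)) -(fineK (finQ x Dx)) !lee_fin; lra.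
have mh : measurable_fun setT h.
  apply/(measurable_restrictT _ mD)/measurable_funTS.
  apply: measurable_funD => //; apply: measurable_funB.
    exact: measurableT_comp mP.
  exact: measurableT_comp mQ.
have hnd s t : (0 <= s -> s <= t -> t <= 1 -> h s <= h t)%R.
  move=> s0 st t1; have Ds : D s by rewrite /D/= in_itv/= s0 (le_trans st).
  have Dt : D t by rewrite /D/= in_itv/= t1 (le_trans s0).
  have := PQ s t s0 st t1; rewrite /h !patchE !mem_set//.
  rewrite -(fineK (finP s Ds)) -(fineK (finQ s Ds)).
  rewrite -(fineK (finP t Dt)) -(fineK (finQ t Dt)).
  by rewrite -!EFinD !lee_fin /=; lra.
have IE r : carried01 r ->
    \int[r]_x (h x)%:E + \int[r]_x Q x = \int[r]_x P x + K%:E.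
  move=> r01.
  have mhE : measurable_fun setT (EFin \o h) by exact/measurable_EFinP.
  rewrite !integral_carried01//.
  have -> : K%:E = \int[r]_(x in D) cst K%:E x.
    by rewrite /D integral_cst//= (carried01_mass r01) mule1.
  have K0 : (0 <= K%:E :> \bar R).
    by apply: (le_trans (P0 0%R)); apply: PK; rewrite lexx ler01.
  rewrite -!ge0_integralD//=; try exact: measurable_funTS.
    by apply: eq_integral => x /set_mem Dx; rewrite hE.
  by move=> x _; rewrite lee_fin.
have hqp := pq h mh h0 hnd.
have fin r (F : R -> \bar R) : carried01 r -> measurable_fun setT F ->
    (forall x, 0 <= F x) -> (forall x, (0 <= x <= 1)%R -> F x <= K%:E) ->
    \int[r]_x F x \is a fin_num.
  move=> r01 mF F0 FK; have /andP[i0 iK] := integral_carried01_fin r01 mF F0 FK.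
  by rewrite ge0_fin_numE// (le_lt_trans iK) ?ltry.
have Eq := IE q q01; have Ep := IE p p01.
rewrite -(leeD2rE (x := K%:E))// addeAC -Eq -addeA [leRHS]addeAC -Ep.
rewrite -[leRHS]addeA [\int[q]_x Q x + _]addeC.
by rewrite leeD2r.
Qed.

End MixtureExchange.

(** * Equalizing the weights of mixtures *)

(** The difference of the two sides is
(x' z' - x z) (cpp + cqq - (cpq + cpq)). *)
Lemma le_bilinear_exchange (R : realType) (x z x' z' cpp cpq cqq : R) :
  x + z = x' + z' -> x * z <= x' * z' -> cpq + cpq <= cpp + cqq ->
  (x%:E * (z%:E * cpp%:E + (1 - z)%:E * cpq%:E) +
   (1 - x)%:E * (z%:E * cpq%:E + (1 - z)%:E * cqq%:E) <=
   x'%:E * (z'%:E * cpp%:E + (1 - z')%:E * cpq%:E) +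
   (1 - x')%:E * (z'%:E * cpq%:E + (1 - z')%:E * cqq%:E))%E.
Proof.
move=> xz le h; rewrite -!EFinM -?EFinD lee_fin -subr_ge0.
have -> : z' = x + z - x' by rewrite xz; ring.
have -> : x' * ((x + z - x') * cpp + (1 - (x + z - x')) * cpq) +
    (1 - x') * ((x + z - x') * cpq + (1 - (x + z - x')) * cqq) -
    (x * (z * cpp + (1 - z) * cpq) + (1 - x) * (z * cpq + (1 - z) * cqq)) =
  (x' * (x + z - x') - x * z) * ((cpp + cqq) - (cpq + cpq)) by ring.
rewrite mulr_ge0// subr_ge0//; apply: le_trans le _.
by rewrite xz [(x' + _ - _)]addrAC subrr add0r.
Qed.

Section RobinHood.
Context (R : realType).
Local Open Scope ereal_scope.
Variables (p q : probability R R) (psi : R -> R).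
Hypotheses (p01 : carried01 p) (q01 : carried01 q) (pq : dominates p q).
Hypotheses (cpsi : convex_real psi) (psi0 : forall x, (0 <= psi x)%R).

Let mpsi : measurable_fun setT (EFin \o psi).
Proof. by apply/measurable_EFinP; exact: measurable_convex_real. Qed.

Let psi0E x : 0 <= (EFin \o psi) x.
Proof. by rewrite lee_fin. Qed.

Let psi_bound (y x x' : R) : (0 <= x <= 1 -> 0 <= x' <= 1 ->
  psi (y + x + x') <= Num.max (psi y) (psi (y + 2)))%R.
Proof.
move=> /andP[x0 x1] /andP[x'0 x'1]; apply: convex_real_le_max => //; lra.
Qed.

Let one_bound r (y x : R) : carried01 r -> (0 <= x <= 1)%R ->
  iter_exp (EFin \o psi) [:: r] (y + x) <= (Num.max (psi y) (psi (y + 2)))%:E.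
Proof.
move=> r01 x01 /=.
suff /andP[] : 0 <= \int[r]_x' (psi (y + x + x'))%:E <=
    (Num.max (psi y) (psi (y + 2)))%:E by [].
apply: integral_carried01_fin => //.
- exact: (measurable_shift (y + x) mpsi).
- by move=> x'; rewrite lee_fin.
- by move=> x' x'01; rewrite lee_fin; exact: psi_bound.
Qed.

Let two_fin r s y : carried01 r -> carried01 s ->
  iter_exp (EFin \o psi) [:: r; s] y \is a fin_num.
Proof.
move=> r01 s01; have /andP[i0 iK] : 0 <= iter_exp (EFin \o psi) [:: r; s] y <=
    (Num.max (psi y) (psi (y + 2)))%:E.
  apply: (@integral_carried01_fin _ r
    (fun x => iter_exp (EFin \o psi) [:: s] (y + x))) => //.
  - by apply: measurable_shift; exact: measurable_iter_exp.
  - by move=> x; exact: iter_exp_ge0.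
  - by move=> x x01; exact: one_bound.
by rewrite ge0_fin_numE// (le_lt_trans iK) ?ltry.
Qed.

(** Domination is used twice. Convexity makes
psi (y + t + _) - psi (y + s + _) nondecreasing for s <= t, so its mean under p
is at least its mean under q; hence the difference of the means of
psi (y + x + _) under p and q is nondecreasing in x, and domination applies to
it again. *)
Lemma two_draws_supermodular y :
  iter_exp (EFin \o psi) [:: q; p] y + iter_exp (EFin \o psi) [:: p; q] y <=
  iter_exp (EFin \o psi) [:: p; p] y + iter_exp (EFin \o psi) [:: q; q] y.
Proof.
apply: (dominates_difference (K := Num.max (psi y) (psi (y + 2)))
    (P := fun x => iter_exp (EFin \o psi) [:: p] (y + x))
    (Q := fun x => iter_exp (EFin \o psi) [:: q] (y + x)) p01 q01 pq).
- by apply: measurable_shift; exact: measurable_iter_exp.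
- by apply: measurable_shift; exact: measurable_iter_exp.
- by move=> x; exact: iter_exp_ge0.
- by move=> x; exact: iter_exp_ge0.
- by move=> x x01; exact: one_bound.
- by move=> x x01; exact: one_bound.
move=> s t s0 st t1; rewrite [leLHS]addeC.
apply: (dominates_difference (K := Num.max (psi y) (psi (y + 2)))
    (P := fun x => (psi (y + t + x))%:E) (Q := fun x => (psi (y + s + x))%:E) p01 q01 pq).
- exact: (measurable_shift (y + t) mpsi).
- exact: (measurable_shift (y + s) mpsi).
- by move=> x; rewrite lee_fin.
- by move=> x; rewrite lee_fin.
- by move=> x x01; rewrite lee_fin psi_bound// (le_trans s0 st).
- by move=> x x01; rewrite lee_fin psi_bound// s0 (le_trans st).
move=> a b a0 ab b1; rewrite -!EFinD lee_fin.
have := @convex_real_increments _ psi (y + s + a) (y + s + b) (t - s) cpsi.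
have -> : (y + s + a + (t - s) = y + t + a)%R by ring.
have -> : (y + s + b + (t - s) = y + t + b)%R by ring.
by rewrite subr_ge0 lerD2l => /(_ st ab); lra.
Qed.

Local Notation W t := (mixture t p q : probability R R).

Let iter_exp_mix2 (a b : {i01 R}) y :
  iter_exp (EFin \o psi) [:: W a; W b] y =
  a%:num%:E * (b%:num%:E * iter_exp (EFin \o psi) [:: p; p] y +
               (1 - b%:num)%:E * iter_exp (EFin \o psi) [:: p; q] y) +
  (1 - a%:num)%:E * (b%:num%:E * iter_exp (EFin \o psi) [:: q; p] y +
               (1 - b%:num)%:E * iter_exp (EFin \o psi) [:: q; q] y).
Proof.
have mi l : measurable_fun setT (fun x => iter_exp (EFin \o psi) l (y + x)%R).
  by apply: measurable_shift; exact: measurable_iter_exp.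
have i0 l x : 0 <= iter_exp (EFin \o psi) l (y + x)%R by exact: iter_exp_ge0.
rewrite [LHS](@integral_mixture _ _ _ a p q
  (fun x => iter_exp (EFin \o psi) [:: W b] (y + x)%R))//.
have step (r : probability R R) : \int[r]_x iter_exp (EFin \o psi) [:: W b] (y + x)%R =
    b%:num%:E * iter_exp (EFin \o psi) [:: r; p] y +
    (1 - b%:num)%:E * iter_exp (EFin \o psi) [:: r; q] y.
  rewrite -[iter_exp _ [:: r; p] y]/(\int[r]_x iter_exp (EFin \o psi) [:: p] (y + x)%R).
  rewrite -[iter_exp _ [:: r; q] y]/(\int[r]_x iter_exp (EFin \o psi) [:: q] (y + x)%R).
  rewrite -!ge0_integralZl//; [|by rewrite lee_fin..].
  rewrite -ge0_integralD//; last 4 first.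
  - by move=> x _; rewrite mule_ge0// lee_fin.
  - by apply: measurable_funeM; exact: mi.
  - by move=> x _; rewrite mule_ge0// lee_fin subr_ge0.
  - by apply: measurable_funeM; exact: mi.
  apply: eq_integral => x _.
  rewrite [LHS](@integral_mixture _ _ _ b p q (fun x' => (psi (y + x + x'))%:E))//.
    exact: (measurable_shift _ mpsi).
  by move=> x'; rewrite lee_fin.
by rewrite !step.
Qed.

Lemma le_iter_exp_mix2 (a b a' b' : {i01 R}) y :
  (a%:num + b%:num = a'%:num + b'%:num)%R -> (a%:num * b%:num <= a'%:num * b'%:num)%R ->
  iter_exp (EFin \o psi) [:: W a; W b] y <= iter_exp (EFin \o psi) [:: W a'; W b'] y.
Proof.
move=> ab abab; rewrite !iter_exp_mix2; have := two_draws_supermodular y.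
have -> : iter_exp (EFin \o psi) [:: q; p] y = iter_exp (EFin \o psi) [:: p; q] y.
  exact: (@iter_exp_cons_cat _ _ q [:: p] [::] y mpsi psi0E).
rewrite -(fineK (two_fin y p01 p01)) -(fineK (two_fin y p01 q01)).
rewrite -(fineK (two_fin y q01 q01)).
by rewrite -EFinD lee_fin; exact: le_bilinear_exchange.
Qed.

(** If a weight a is not th, then some other weight b lies on the other side of
th, since th is the average. Replacing a and b by th and a + b - th keeps the sum
without lowering the product, and leaves one weight fewer to equalize. *)
Lemma iter_exp_equalize (th : {i01 R}) (ts : seq {i01 R}) l y :
  (\sum_(t <- ts) t%:num = (size ts)%:R * th%:num)%R ->
  iter_exp (EFin \o psi) (map (fun t => W t) ts ++ l) y <=
  iter_exp (EFin \o psi) (nseq (size ts) (W th) ++ l) y.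
Proof.
have [n] := ubnP (size ts); elim: n ts y => // n IH [|a ts] y // sn Es.
have mi l' : measurable_fun setT (iter_exp (EFin \o psi) l').
  exact: measurable_iter_exp.
have i0 l' x : 0 <= iter_exp (EFin \o psi) l' x by exact: iter_exp_ge0.
have peel (ts' : seq {i01 R}) : size ts' = size ts ->
    (\sum_(t <- ts') t%:num = (size ts)%:R * th%:num)%R ->
    iter_exp (EFin \o psi) ((W th) :: map (fun t => W t) ts' ++ l) y <=
    iter_exp (EFin \o psi) ((W th) :: nseq (size ts) (W th) ++ l) y.
  move=> sts Ets; rewrite /=; apply: ge0_le_integral => //.
  - exact: measurable_shift.
  - exact: measurable_shift.
  - by move=> x _; rewrite -sts; apply: IH; rewrite ?sts.
move: Es; rewrite big_cons [size (a :: ts)]/= -natr1 mulrDl mul1r => Es.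
have [ath|nath] := eqVneq a%:num%R th%:num%R.
  have -> : a = th by exact/val_inj.
  by apply: peel => //; move: Es; rewrite ath addrC => /addIr.
(* otherwise all the products (a - th) (b - th) would be nonnegative, although
   they sum to - (a - th) ^+ 2 *)
have [b bts hb] : exists2 b, b \in ts & (0 <= (a%:num - th%:num) * (th%:num - b%:num))%R.
  apply: contrapT => nb.
  have : (0 <= \sum_(b <- ts) (a%:num - th%:num) * (b%:num - th%:num))%R.
    rewrite big_seq; apply: sumr_ge0 => b bts; rewrite leNgt; apply/negP => ab.
    apply: nb; exists b => //; rewrite -oppr_le0.
    by rewrite (_ : (- _ = (a%:num - th%:num) * (b%:num - th%:num))%R) ?ltW//; ring.
  rewrite -mulr_sumr big_split/= sumrN big_const_seq count_predT iter_addr addr0.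
  have -> : (\sum_(t <- ts) t%:num = (size ts)%:R * th%:num + th%:num - a%:num)%R.
    by rewrite -Es; ring.
  rewrite mulr_natl (_ : _ + _ - _ - _ = - (a%:num - th%:num))%R; last by ring.
  rewrite mulrN oppr_ge0 -expr2 => sq; have := sqr_ge0 (a%:num - th%:num)%R.
  move=> sq'; have /eqP := @le_anti _ _ _ _ (introT andP (conj sq sq')).
  by rewrite sqrf_eq0 subr_eq0 (negbTE nath).
have e01 : (0 <= a%:num + b%:num - th%:num <= 1)%R.
  have a0 : (0 <= a%:num)%R by []. have a1 : (a%:num <= 1)%R by [].
  have b0 : (0 <= b%:num)%R by []. have b1 : (b%:num <= 1)%R by [].
  move: hb; have [h|h|h] := ltgtP (a%:num - th%:num)%R 0%R.
  - by rewrite nmulr_rge0// => hb; apply/andP; split; lra.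
  - by rewrite pmulr_rge0// => hb; apply/andP; split; lra.
  - by move/eqP: h; rewrite subr_eq0 (negbTE nath).
have [/= e0 e1] := andP e01.
pose e := Itv01 e0 e1.
(* move a and b to the innermost positions, where the exchange is made *)
have pts : perm_eq (a :: ts) (a :: b :: rem b ts) by rewrite perm_cons perm_to_rem.
pose r := map (fun t => W t) (rem b ts) ++ l.
rewrite [leLHS](_ : _ =
    iter_exp (EFin \o psi) (r ++ [:: W a; W b] ++ [::]) y); last first.
  rewrite -(@iter_exp_catCA _ _ [:: W a; W b])// cats0.
  rewrite -[LHS]/(iter_exp (EFin \o psi) (map (fun t => W t) (a :: ts) ++ l) y).
  rewrite -[RHS]/(iter_exp (EFin \o psi)
    (map (fun t => W t) (a :: b :: rem b ts) ++ l) y).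
  by rewrite !iter_exp_cat; exact: iter_exp_perm.
rewrite -[leRHS]/(iter_exp (EFin \o psi) ((W th) :: nseq (size ts) (W th) ++ l) y).
apply: (@le_trans _ _ (iter_exp (EFin \o psi) (r ++ [:: W th; W e] ++ [::]) y)).
  rewrite !cats0 (iter_exp_cat _ r [:: W a; _]) (iter_exp_cat _ r [:: W th; _]).
  apply: le_iter_exp => //.
  move=> x; apply: le_iter_exp_mix2 => /=; first by ring.
  rewrite -subr_ge0; apply: le_trans hb _; rewrite le_eqVlt; apply/orP; left.
  by apply/eqP; ring.
rewrite -(@iter_exp_catCA _ _ [:: W th; W e])// cats0.
rewrite -[leLHS]/(iter_exp (EFin \o psi)
  (W th :: map (fun t => W t) (e :: rem b ts) ++ l) y).
have sz : (size (rem b ts)).+1 = size ts.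
  by rewrite size_rem// prednK//; case: (ts) bts.
apply: peel; first by rewrite /= sz.
rewrite big_cons /=.
have : (\sum_(t <- ts) t%:num = b%:num + \sum_(t <- rem b ts) t%:num)%R.
  by rewrite (perm_big _ (perm_to_rem bts)) big_cons.
by move=> Eb; rewrite -[RHS](addrK th%:num%R) -Es Eb; ring.
Qed.

End RobinHood.

(** * Conditional laws of the response given a cell *)

Section CellLaw.
Context dT (T : measurableType dT) (R : realType).
Local Open Scope ereal_scope.
Variables (mu : probability T R) (f : {mfun T >-> R}).

(** The law of f given D; the value for a set D that is not measurable is a
dummy that makes the definition total. *)
Definition cell_law (D : set T) : probability R R :=
  match pselect (measurable D) with
  | left mD => distribution (mnormalize (mrestr mu mD) mu) f
  | right _ => distribution mu f
  end.

Let mnormalize_mrestrE (D : set T) (mD : measurable D) A : 0 < mu D ->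
  mnormalize (mrestr mu mD) mu A = mu (A `&` D) * ((fine (mu D))^-1)%:E.
Proof.
move=> D0; have E : mrestr mu mD setT = mu D by rewrite /mrestr setTI.
rewrite /mnormalize/= E.
by rewrite gt_eqF//= (lt_eqF (le_lt_trans (probability_le1 mu mD) (ltry 1%R))).
Qed.

Lemma cell_lawE (D : set T) A : measurable D -> 0 < mu D ->
  cell_law D A = mu (f @^-1` A `&` D) * ((fine (mu D))^-1)%:E.
Proof.
move=> mD D0; rewrite /cell_law; case: pselect => // mD'.
exact: mnormalize_mrestrE.
Qed.

Lemma cell_law_cond_law (D : set T) A : measurable D -> 0 < mu D ->
  cell_law D A = cond_law mu D (f @^-1` A).
Proof.
move=> mD D0; rewrite cell_lawE// /cond_law; congr (_ * _).
have Dfin : mu D \is a fin_num by exact: fin_num_measure.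
have invE (x : \bar R) : 0 < x -> x \is a fin_num -> ((fine x)^-1)%:E = x^-1.
  by case: x => // r r0 _; rewrite inver gt_eqF.
exact: invE.
Qed.

Lemma integral_cell_law (D : set T) (h : R -> \bar R) :
  measurable D -> 0 < mu D ->
  measurable_fun setT h -> (forall x, 0 <= h x) ->
  \int[cell_law D]_x h x = (fine (mu D))^-1%:E * \int[mu]_(u in D) h (f u).
Proof.
move=> mD D0 mh h0; rewrite /cell_law; case: pselect => // mD'.
rewrite ge0_integral_distribution//.
set c := (fine (mu D))^-1%R.
have c0 : (0 <= c)%R by rewrite invr_ge0 fine_ge0.
have mhf : measurable_fun setT (h \o f) by exact: measurableT_comp.
rewrite (@integral_density _ _ _ mu _ (fun x => c * \1_D x)%R)//.
- rewrite -ge0_integralZl//; last exact: (measurable_funTS mhf).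
  rewrite [RHS]integral_mkcond; apply: eq_integral => x _.
  rewrite patchE indicE; case: ifPn => _; last by rewrite mulr0 mule0.
  by rewrite mulr1 muleC.
- by apply: measurable_funM => //; exact: measurable_indic.
- by move=> x; rewrite mulr_ge0.
- move=> A mA; rewrite [LHS]mnormalize_mrestrE//.
  under eq_integral do rewrite EFinM.
  rewrite ge0_integralZl//; last by apply/measurable_EFinP; exact: measurable_indic.
  by rewrite integral_indic// muleC setIC.
- by move=> x; exact: h0.
Qed.

Lemma cell_law_carried01 (D : set T) : measurable D -> 0 < mu D ->
  (forall x, D x -> 0 <= f x <= 1)%R -> carried01 (cell_law D).
Proof.
move=> mD D0 f01; rewrite /carried01 cell_lawE//.
rewrite (_ : _ `&` D = set0) ?measure0 ?mul0e//.
by rewrite -subset0 => x [/= nfx /f01 fx]; apply: nfx; rewrite /= in_itv.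
Qed.

(** The law of total probability. *)
Lemma cell_law_mixture (D D1 D2 : set T) (t : {i01 R}) A :
  measurable D1 -> measurable D2 -> D1 `&` D2 = set0 -> D = D1 `|` D2 ->
  0 < mu D1 -> 0 < mu D2 -> mu D1 = t%:num%:E * mu D -> measurable A ->
  cell_law D A = mixture t (cell_law D1) (cell_law D2) A.
Proof.
move=> mD1 mD2 D12 DE p1 p2 tE mA; rewrite mixtureE.
have mD : measurable D by rewrite DE; exact: measurableU.
have mfA : measurable (f @^-1` A).
  by rewrite -[X in measurable X]setTI; exact: measurable_funP.
have muD : mu D = mu D1 + mu D2 by rewrite DE measureU.
have p : 0 < mu D by rewrite muD adde_gt0.
have fin B : measurable B -> mu B \is a fin_num by move=> ?; exact: fin_num_measure.
have mI1 : measurable (f @^-1` A `&` D1) by exact: measurableI.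
have mI2 : measurable (f @^-1` A `&` D2) by exact: measurableI.
have muID : mu (f @^-1` A `&` D) = mu (f @^-1` A `&` D1) + mu (f @^-1` A `&` D2).
  by rewrite DE setIUr measureU// setIACA D12 setI0.
rewrite !cell_lawE// muID.
have pf B : measurable B -> 0 < mu B -> (0 < fine (mu B))%R.
  by move=> mB B0; rewrite fine_gt0// B0 ltey_eq fin.
have := pf _ mD p; have := pf _ mD1 p1; have := pf _ mD2 p2.
move: tE muD.
rewrite -(fineK (fin _ mD1)) -(fineK (fin _ mD2)) -(fineK (fin _ mD)).
rewrite -(fineK (fin _ mI1)) -(fineK (fin _ mI2)).
move: (fine (mu D1)) (fine (mu D2)) (fine (mu D)).
move: (fine (mu (_ `&` D1))) (fine (mu (_ `&` D2))).
move=> x1 x2 d1 d2 d tE [dE] d20 d10 d0; rewrite -!EFinM -!EFinD.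
have te : d1 = (t%:num * d)%R by case: tE.
have -> : t%:num = (d1 / d)%R by rewrite te mulfK// gt_eqF.
rewrite /= in d20 d10 d0 *; congr (_%:E); rewrite dE; field.
by rewrite -dE !gt_eqF.
Qed.

End CellLaw.

Section CellLawDominance.
Context (R : realType) (d : nat).
Local Open Scope ereal_scope.

Lemma cell_law_dominates (mu : probability (d.-tuple R) R) (f : {mfun (d.-tuple R) >-> R})
    (D : set (d.-tuple R)) j a :
  MTP2 mu -> nondecreasing_coord f -> (forall x, cube x -> 0 <= f x <= 1)%R ->
  measurable D -> D `<=` cube -> lattice_set D -> measurable (halfcube j a) ->
  0 < mu (D `&` halfcube j a) -> 0 < mu (D `&` ~` halfcube j a) ->
  dominates (cell_law mu f (D `&` halfcube j a)) (cell_law mu f (D `&` ~` halfcube j a)).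
Proof.
move=> muM fnd f01 mD Dc lD mG p1 p2 h mh h0 hnd.
have mD1 : measurable (D `&` halfcube j a) by exact: measurableI.
have mD2 : measurable (D `&` ~` halfcube j a).
  by apply: measurableI => //; exact: measurableC.
rewrite !integral_cell_law//; try exact/measurable_EFinP.
have pf B : measurable B -> 0 < mu B -> (0 < fine (mu B))%R.
  by move=> mB B0; rewrite fine_gt0// B0 ltey_eq fin_num_measure.
have q1 := pf _ mD1 p1; have q2 := pf _ mD2 p2.
rewrite lee_pdivrMl// muleCA lee_pdivlMl//.
rewrite !fineK ?fin_num_measure//.
by rewrite muleC [leRHS]muleC; exact: MTP2_dominance.
Qed.

End CellLawDominance.

(** * Undoing the splits of a partition *)

Section Refinement.
Context (R : realType) (d n : nat) (mu : probability (d.-tuple R) R).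
Context (f : {mfun (d.-tuple R) >-> R}).
Local Open Scope ereal_scope.
Implicit Types (P : set (set (d.-tuple R))) (s : seq (set (d.-tuple R))).
Hypothesis n_gt0 : (0 < n)%N.
Hypothesis mu_MTP2 : MTP2 mu.
Hypothesis fnd : nondecreasing_coord f.
Hypothesis f01 : forall x, cube x -> (0 <= f x <= 1)%R.

(** What is used of an admissible partition, for its set of cells: two cells
that meet are equal, so the list order and repetitions are forgotten. *)
Definition good_cells P :=
  (forall D, P D -> [/\ measurable D, 0 < mu D & D `<=` cube]) /\
  (forall D D', P D -> P D' -> D `&` D' !=set0 -> D = D').

(** An associated partition recorded as the list of the cells of the n points;
the order of the list is immaterial. *)
Definition allocation P s :=
  (forall D, D \in s -> P D) /\
  (forall D, P D -> mu D = ((count_mem D s)%:R / n%:R)%:E).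

Lemma allocation_count P s D (k : nat) : mu D = (k%:R / n%:R)%:E ->
  allocation P s -> P D -> count_mem D s = k.
Proof.
move=> muD [_ sP] /sP; rewrite muD => -[] /eqP.
have n0 : (n%:R != 0 :> R)%R by rewrite pnatr_eq0 -lt0n.
by rewrite (inj_eq (mulIf _)) ?invr_eq0// eqr_nat => /eqP.
Qed.

Lemma allocation_perm P s1 s2 :
  allocation P s1 -> allocation P s2 -> perm_eq s1 s2.
Proof.
move=> a1 a2; apply/allP => D; rewrite mem_cat => Ds /=; apply/eqP.
have PD : P D by case/orP: Ds; [exact: a1.1|exact: a2.1].
by apply: (allocation_count (a2.2 _ PD) a1 PD).
Qed.

Lemma measurable_halfcube (j : 'I_d) (a : R) :
  measurable (halfcube j a).
Proof.
rewrite (_ : halfcube j a =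
  (\bigcap_(i in [set: 'I_d]) ((@tnth d R)^~ i @^-1` `[0%R, 1%R]%classic)) `&`
  ((@tnth d R)^~ j @^-1` `[a, +oo[%classic)).
  apply: measurableI; last first.
    by rewrite -[X in measurable X]setTI; exact: measurable_tnth.
  apply: fin_bigcap_measurable => [|i _]; first exact: finite_finset.
  by rewrite -[X in measurable X]setTI; exact: measurable_tnth.
apply/seteqP; split => x /=.
  move=> [cx ax]; split; last by rewrite in_itv/= andbT.
  by move=> i _; rewrite /= in_itv/=; exact: cx.
move=> [cx]; rewrite in_itv/= andbT => ax; split => // i.
by have := cx i I; rewrite /= in_itv.
Qed.

(** Undoing one split: each point allotted to one of the two halves is allotted
to the whole cell D0. The laws of the points of the halves are mixtures with
weights 1 and 0 of the two conditional laws; after merging they all have the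
weight th, the proportion of the points that were in the upper half. *)
Lemma coarsen P P' D0 j a s' :
  good_cells P -> good_cells P' -> P D0 -> lattice_set D0 ->
  P' = (P `\ D0) `|` [set D0 `&` halfcube j a; D0 `&` ~` halfcube j a] ->
  allocation P' s' ->
  exists2 s, allocation P s & forall psi y,
    convex_real psi -> (forall x, 0 <= psi x)%R ->
    iter_exp (EFin \o psi) (map (cell_law mu f) s') y <=
    iter_exp (EFin \o psi) (map (cell_law mu f) s) y.
Proof.
move=> gP gP' PD0 lD0 P'E al'.
set D1 := D0 `&` halfcube j a in P'E *; set D2 := D0 `&` ~` halfcube j a in P'E *.
have P'1 : P' D1 by rewrite P'E; right; left.
have P'2 : P' D2 by rewrite P'E; right; right.
have [mD0 p0 D0c] := gP.1 _ PD0.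
have [mD1 p1 D1c] := gP'.1 _ P'1.
have [mD2 p2 D2c] := gP'.1 _ P'2.
have ne D : 0 < mu D -> D !=set0.
  by move=> D_gt0; apply/set0P; apply: contraTneq D_gt0 => ->; rewrite measure0 ltxx.
have D12 : D1 `&` D2 = set0 by rewrite /D1 /D2 setIACA setICr setI0.
have D0E : D0 = D1 `|` D2 by rewrite /D1 /D2 -setIUr setUv setIT.
have muD0 : mu D0 = mu D1 + mu D2 by rewrite {1}D0E measureU.
have nD12 : (D2 == D1) = false.
  apply/negbTE/eqP => D21; have [x D1x] := ne _ p1.
  have : (D1 `&` D2) x by rewrite D21.
  by rewrite D12.
have sub1 : D1 `<=` D0 by move=> x [].
have sub2 : D2 `<=` D0 by move=> x [].
have notP E : P E -> E `<=` D0 -> 0 < mu E -> D0 = E.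
  move=> PE ED0 /ne[x Ex]; apply: gP.2 => //; exists x; split => //; exact: ED0.
have n1 : D1 <> D0.
  move=> D10; have [x D2x] := ne _ p2.
  have : (D1 `&` D2) x by split => //; rewrite D10; exact: sub2.
  by rewrite D12.
have n2 : D2 <> D0.
  move=> D20; have [x D1x] := ne _ p1.
  have : (D1 `&` D2) x by split => //; rewrite D20; exact: sub1.
  by rewrite D12.
pose A := [pred E : set (d.-tuple R) | (E == D1) || (E == D2)].
pose merge E := if A E then D0 else E.
have s'P E : E \in s' -> ~~ A E -> P E /\ E <> D0.
  move=> /al'.1; rewrite P'E => -[[PE ED0] _|[->|->]]; first by [].
  - by rewrite /= eqxx.
  - by rewrite /= eqxx orbT.
have c1 : mu D1 = ((count_mem D1 s')%:R / n%:R)%:E by exact: al'.2.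
have c2 : mu D2 = ((count_mem D2 s')%:R / n%:R)%:E by exact: al'.2.
have cA : count A s' = (count_mem D1 s' + count_mem D2 s')%N.
  rewrite -[RHS]count_predUI.
  have -> : count (predI (pred1 D1) (pred1 D2)) s' = 0%N.
    rewrite -(count_pred0 s'); apply: eq_count => E /=.
    by apply/negbTE/andP => -[/eqP -> /eqP D1D2]; rewrite D1D2 eqxx in nD12.
  by rewrite addn0.
have al : allocation P (map merge s').
  split=> [_ /mapP[E Es' ->]|D PD].
    by rewrite /merge; case: ifPn => // nAE; have [] := s'P E Es' nAE.
  rewrite count_map; have [->|DD0] := eqVneq D D0.
    rewrite muD0 c1 c2 -EFinD -mulrDl -natrD -cA; congr (_%:R / _)%:E.
    apply: eq_in_count => E Es' /=; rewrite /merge.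
    case: ifPn => [AE|AE]; first by rewrite eqxx; exact: AE.
    have [_ ED0] := s'P E Es' AE; rewrite (negbTE (_ : E != D0)); last exact/eqP.
    exact/negbTE.
  have P'D : P' D by rewrite P'E; left; split => //=; move/eqP: DD0.
  rewrite (al'.2 _ P'D); congr (_%:R / _)%:E.
  apply: eq_in_count => E Es' /=; rewrite /merge.
  case: ifPn => // AE.
  rewrite eq_sym [RHS]eq_sym (negbTE DD0); apply/negbTE/eqP => DE.
  case/negP: DD0; apply/eqP/esym; apply: notP => //.
  - by rewrite DE; case/orP: AE => /eqP ->.
  - by rewrite DE; case/orP: AE => /eqP ->.
exists (map merge s') => // psi y cpsi psi0.
have mpsi : measurable_fun setT (EFin \o psi).
  by apply/measurable_EFinP; exact: measurable_convex_real.
have psi0E x : 0 <= (EFin \o psi) x by rewrite lee_fin.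
have ps' : perm_eq s' (seq.filter A s' ++ seq.filter (predC A) s').
  by rewrite perm_sym; exact/permPl/perm_filterC.
rewrite (iter_exp_perm _ _ mpsi psi0E ps').
rewrite (iter_exp_perm _ _ mpsi psi0E (perm_map merge ps')).
rewrite !map_cat -map_comp.
rewrite (_ : [seq merge i | i <- seq.filter (predC A) s'] =
  seq.filter (predC A) s'); last first.
  rewrite -[RHS]map_id; apply/eq_in_map => E; rewrite mem_filter /= => /andP[nAE _].
  by rewrite /merge ifN.
rewrite !iter_exp_cat.
have p1f : (0 < fine (mu D1))%R by rewrite fine_gt0// p1 ltey_eq fin_num_measure.
have p0f : (0 < fine (mu D0))%R by rewrite fine_gt0// p0 ltey_eq fin_num_measure.
have th0 : (0 <= fine (mu D1) / fine (mu D0))%R by rewrite divr_ge0// ltW.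
have th1 : (fine (mu D1) / fine (mu D0) <= 1)%R.
  rewrite ler_pdivrMr// mul1r fine_le ?fin_num_measure// muD0.
  by rewrite leeDl.
pose th : {i01 R} := Itv01 th0 th1.
have muth : mu D1 = th%:num%:E * mu D0.
  rewrite -[in RHS](fineK (fin_num_measure mu _ mD0)) -EFinM /= divfK ?gt_eqF//.
  by rewrite fineK// fin_num_measure.
pose W (t : {i01 R}) : probability R R := mixture t (cell_law mu f D1) (cell_law mu f D2).
pose t (E : set (d.-tuple R)) : {i01 R} :=
  if E == D1 then Itv01 ler01 (lexx 1%R) else Itv01 (lexx 0%R) ler01.
rewrite (@eq_iter_exp _ _ _ (W \o t)); last first.
  move=> E; rewrite mem_filter => /andP[AE _] B mB; rewrite /W /t /= mixtureE.
  case/orP: AE => /eqP ->; rewrite ?eqxx ?nD12 /=.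
    by rewrite subrr mul1e mul0e adde0.
  by rewrite subr0 mul1e mul0e add0e.
rewrite (@eq_iter_exp _ _ (cell_law mu f \o merge) (fun=> W th)); last first.
  move=> E; rewrite mem_filter => /andP[AE _] B mB; rewrite /W /= /merge AE.
  exact: cell_law_mixture.
rewrite map_comp -!iter_exp_cat.
have -> : map (fun=> W th) (seq.filter A s') =
    nseq (size (map t (seq.filter A s'))) (W th).
  by rewrite size_map; elim: (seq.filter A s') => //= E s ->.
apply: iter_exp_equalize => //.
- by apply: cell_law_carried01 => // x D1x; apply: f01; exact: D1c.
- by apply: cell_law_carried01 => // x D2x; apply: f01; exact: D2c.
- by apply: cell_law_dominates => //; exact: measurable_halfcube.
rewrite size_map size_filter big_map big_filter.
have -> : (\sum_(E <- s' | A E) (t E)%:num = (count_mem D1 s')%:R :> R)%R.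
  rewrite -sum1_count natr_sum [RHS]big_mkcond [LHS]big_mkcond; apply: eq_bigr => E _ /=.
  by rewrite /t; case: (E == D1); case: (E == D2).
move: muth; rewrite muD0 c1 c2 -EFinD -mulrDl -natrD -cA -EFinM => -[].
have n0 : (n%:R != 0 :> R)%R by rewrite pnatr_eq0 -lt0n.
by rewrite mulrA => /(mulIf _) ->; rewrite ?invr_eq0// mulrC.
Qed.

Lemma admissible_good_cells C : admissible n mu C -> good_cells [set` C].
Proof.
move=> [mC tC UC [k [kC _]]].
have cellP D : D \in C -> exists2 i, (i < size C)%N & D = cell C i.
  by move=> DC; exists (index D C); rewrite ?index_mem// /cell nth_index.
split => [D /cellP[i iC ->]|D D' /cellP[i iC ->] /cellP[i' iC' ->]].
  split; first exact: mC.
    have [/andP[k1 _] ->] := kC (Ordinal iC).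
    by rewrite lte_fin divr_gt0// ltr0n.
  by rewrite -UC => x Cx; exists i.
by move=> /tC ->.
Qed.

Lemma splits_lattice C C' : good_cells [set` C] ->
  (forall D, D \in C -> lattice_set D) -> splits C C' ->
  forall D, D \in C' -> lattice_set D.
Proof.
move=> gC lC [i [j [a [iC _ C'E]]]] D DC'.
have iCC : cell C i \in C by rewrite mem_nth.
have [_ _ Cc] := gC.1 _ iCC.
have [l1 l2] := @lattice_split _ _ (cell C i) j a Cc (lC _ iCC).
have : [set` C'] D by [].
by rewrite C'E => -[[/= DC _]|[->|->]]; [exact: lC|exact: l1|exact: l2].
Qed.

Lemma coarsen_chain (CC : nat -> seq (set (d.-tuple R))) (m : nat) :
  (forall k, (1 <= k <= m)%N -> admissible n mu (CC k)) ->
  (forall k, (1 <= k < m)%N -> splits (CC k) (CC k.+1)) ->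
  (forall D, D \in CC 1%N -> lattice_set D) ->
  forall k s', (1 <= k <= m)%N -> allocation [set` CC k] s' ->
  exists2 s, allocation [set` CC 1%N] s & forall psi y,
    convex_real psi -> (forall x, 0 <= psi x)%R ->
    iter_exp (EFin \o psi) (map (cell_law mu f) s') y <=
    iter_exp (EFin \o psi) (map (cell_law mu f) s) y.
Proof.
move=> CCadm CCsplit CC1.
have CClat k : (1 <= k <= m)%N -> forall D, D \in CC k -> lattice_set D.
  elim: k => // -[_ _|k IH /andP[_ km]]; first exact: CC1.
  apply: (splits_lattice _ (IH _) (CCsplit k.+1 _)) => //=; last exact: ltnW.
  by apply: admissible_good_cells; apply: CCadm; rewrite /= ltnW.
elim=> // -[|k] IH s' /andP[_ km] al'; first by exists s'.
have km' : (1 <= k.+1 <= m)%N by rewrite /= ltnW.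
have [i [j [a [iC _ CE]]]] := CCsplit k.+1 km.
have iCC : cell (CC k.+1) i \in CC k.+1 by rewrite mem_nth.
have [s al le1] := coarsen (admissible_good_cells (CCadm _ km'))
  (admissible_good_cells (CCadm k.+2 km)) iCC (CClat _ km' _ iCC) CE al'.
have [s1 al1 le2] := IH s km' al.
exists s1 => // psi y cpsi psi0.
exact: le_trans (le1 _ _ cpsi psi0) (le2 _ _ cpsi psi0).
Qed.

(** Since the blocks of an associated partition cover the indices and are
disjoint, they assign a cell to each index, with the right multiplicities. *)
Lemma associated_allocation B (Bs : seq {set 'I_n}) :
  admissible n mu B -> associated mu B Bs ->
  exists c : 'I_n -> set (d.-tuple R),
    (forall j, exists i, [/\ (i < size B)%N, j \in star Bs i & c j = cell B i]) /\
    allocation [set` B] (map c (enum 'I_n)).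
Proof.
move=> Badm [sB muB dB cB].
have gB := admissible_good_cells Badm.
pose ix j := s2val (cid2 (cB j)).
have ixB j : (ix j < size B)%N by exact: (s2valP (cid2 (cB j))).
have ixs j : j \in star Bs (ix j) by exact: (s2valP' (cid2 (cB j))).
exists (fun j => cell B (ix j)); split; first by move=> j; exists (ix j).
split=> [_ /mapP[j _ ->]|D /= DB]; first by rewrite /= mem_nth.
have iB : (index D B < size B)%N by rewrite index_mem.
have DE : D = cell B (index D B) by rewrite /cell nth_index.
rewrite {1}DE muB//; congr (_%:R / _)%:E.
rewrite count_map enumT cardE size_filter.
apply: eq_count => j /=; apply/idP/eqP => [jD|cD].
  have [->//|/eqP ne] := eqVneq (ix j) (index D B).
  have := dB _ _ (ixB j) iB ne; move/setP/(_ j).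
  by rewrite !inE jD ixs.
have [_ tB _ _] := Badm; have [D1 [x Dx]] : D = cell B (ix j) /\ D !=set0.
  split=> //; have [_ D0 _] := gB.1 _ DB.
  by apply/set0P; apply: contraTneq D0 => ->; rewrite measure0 ltxx.
suff <- : ix j = index D B by exact: ixs.
by apply: (tB _ _ (ixB j) iB); exists x; split; [rewrite -D1|rewrite -DE].
Qed.

End Refinement.

(** * The law of the estimator as an iterated expectation *)

Section IndependentSum.
Context dO (Om : measurableType dO) (R : realType) (P : probability Om R).
Context (I : finType) (X : I -> {mfun Om >-> R}).
Local Open Scope ereal_scope.
Hypothesis X_indep : mutually_independent P
  (fun i => preimage_set_system setT (X i) measurable).

(** On boxes, independence says that the joint law of the variables is the
product of their laws; hence it is this product everywhere. *)
Lemma integral_independent_sum (x0 : I) (r : seq I) (h : R -> \bar R) : uniq r ->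
  measurable_fun setT h -> (forall x, 0 <= h x) ->
  \int[P]_w h (\sum_(i <- r) X i w)%R =
  iter_exp h (map (fun i => distribution P (X i) : probability R R) r) 0%R.
Proof.
move=> ur mh h0.
pose D i : probability R R := distribution P (X i).
rewrite -/D; set l := map D r.
have sl : size l = size r by rewrite size_map.
pose Z w : (size l).-tuple R := [tuple X (nth x0 r j) w | j < size l].
have mZ : measurable_fun setT Z.
  apply/measurable_fun_tnthP => j.
  rewrite (_ : _ \o _ = X (nth x0 r j)); first exact: measurable_funP.
  by apply/funext => w /=; rewrite tnth_mktuple.
pose Zm : {mfun Om >-> (size l).-tuple R} :=
  HB.pack Z (isMeasurableFun.Build _ _ _ _ Z mZ).
rewrite -(integral_tprod_iter_exp (D x0) l)//.
rewrite (eq_measure_integral (distribution P Zm)); last first.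
  move=> S mS _; apply/esym/tprod_unique => // A mA.
  (* A extended to all natural numbers, to reindex products freely *)
pose A2 k := (if insub k is Some j then A j else [set: R]).
  have A2E (j : 'I_(size l)) : A j = A2 j by rewrite /A2 valK.
  have mA2 k : measurable (A2 k) by rewrite /A2; case: insub.
  pose B i := X i @^-1` A2 (index i r).
  transitivity (P (\bigcap_(i in [set` [set i in r]%SET]) B i)).
    rewrite -[LHS]/(P (Z @^-1` box A)); congr (P _); apply/seteqP; split => w /=.
      move=> Aw i /=; rewrite inE => ir; rewrite /B /=.
      have il : (index i r < size l)%N by rewrite sl index_mem.
      have := Aw (Ordinal il); rewrite A2E /= tnth_mktuple /= nth_index//.
    move=> Bw j; rewrite A2E /= tnth_mktuple.
    have jr : (j < size r)%N by rewrite -sl.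
    have := Bw (nth x0 r j); rewrite /= inE mem_nth// /B /= index_uniq//; exact.
  rewrite X_indep; last first.
    by move=> i _; exists (A2 (index i r)) => //; rewrite setTI.
  rewrite (eq_bigl (fun i => i \in r)); last by move=> i; rewrite inE.
  rewrite -big_uniq//= (big_nth x0) -sl big_mkord; apply: eq_bigr => j _.
  have jr : (j < size r)%N by rewrite -sl.
  by rewrite /B index_uniq// A2E /l (nth_map x0).
rewrite ge0_integral_distribution//; last first.
  apply: measurableT_comp => //; apply: measurable_funD => //.
  by apply: measurable_sum => i; exact: measurable_tnth.
apply: eq_integral => w _ /=; rewrite add0r (big_nth x0) -sl big_mkord.
by congr (h _); apply: eq_bigr => j _; rewrite tnth_mktuple.
Qed.

End IndependentSum.

Section SampleRepresentation.
Context (R : realType) (d n : nat) (mu : probability (d.-tuple R) R).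
Context (f : {mfun (d.-tuple R) >-> R}) (f0 : d.-tuple R -> R) (nu : probability R R).
Hypothesis ff0 : forall x, cube x -> f x = f0 x.
Hypothesis n_gt0 : (0 < n)%N.
Context dO (Om : measurableType dO) (P : probability Om R).
Variables (B : seq (set (d.-tuple R))) (Bs : seq {set 'I_n}).
Variables (V : 'I_n -> {RV P >-> d.-tuple R}) (E : 'I_n -> {RV P >-> R}).
Hypothesis B_adm : admissible n mu B.
Hypothesis Bs_assoc : associated mu B Bs.
Hypothesis sampleB : IE_sample mu nu B Bs V E.

Lemma big_star (S : Type) (idx : S) (op : Monoid.com_law idx) (F : 'I_n -> S) :
  \big[op/idx]_(i < size Bs) \big[op/idx]_(j in star Bs i) F j =
  \big[op/idx]_(j < n) F j.
Proof.
rewrite (exchange_big_dep xpredT)//=.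
apply: eq_bigr => j _; have [sB _ dB /(_ j)[i iB ji]] := Bs_assoc.
have iBs : (i < size Bs)%N by rewrite sB.
rewrite (big_pred1 (Ordinal iBs))// => i' /=; apply/idP/eqP => [ji'|->//].
apply/val_inj => /=; apply: contrapT => ne.
have := dB i' i _ iB ne; rewrite -sB ltn_ord => /(_ isT) /setP/(_ j).
by rewrite !inE ji ji'.
Qed.

Lemma W_IE_sum w : W_IE f0 Bs V E w =
  n%:R^-1 * (\sum_(j <- enum 'I_n) E j w + \sum_(j <- enum 'I_n) f (V j w)).
Proof.
rewrite /W_IE; congr (_ * _).
rewrite [LHS](big_star _ (fun j => f0 (V j w) + E j w)) addrC -big_split/= big_enum/=.
by apply: eq_bigr => j _; rewrite ff0//; exact: IE_cube sampleB _ _.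
Qed.

Let X (s : 'I_n + 'I_n) : {mfun Om >-> R} :=
  match s with
  | inl j => f \o V j
  | inr j => E j
  end.

Lemma sample_independent : mutually_independent P
  (fun s => preimage_set_system setT (X s) measurable).
Proof.
move=> J A XA; apply: (IE_indep sampleB) => -[j|j] /XA //=.
move=> [S mS <-]; exists (f @^-1` S); last by [].
by rewrite -[X in measurable X]setTI; exact: measurable_funP.
Qed.

(** The noise is put first in the list, so that it is integrated last and the
comparison of partitions is made for a fixed value of the noise. *)
Lemma integral_W_IE (c : 'I_n -> set (d.-tuple R)) (psi : R -> R) :
  (forall j, exists i, [/\ (i < size B)%N, j \in star Bs i & c j = cell B i]) ->
  measurable_fun setT psi -> (forall x, 0 <= psi x) ->
  (\int[P]_w (psi (W_IE f0 Bs V E w))%:E =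
   iter_exp (iter_exp (fun y => (psi (n%:R^-1 * y))%:E)
     (map (cell_law mu f) (map c (enum 'I_n)))) (map (fun=> nu) (enum 'I_n)) 0)%E.
Proof.
move=> cB mpsi psi0.
have gB := admissible_good_cells n_gt0 B_adm.
set h := fun y : R => _.
have mh : measurable_fun setT h.
  apply/measurable_EFinP; apply: measurableT_comp mpsi _.
  exact: measurable_funM.
have h0 x : (0 <= h x)%E by rewrite lee_fin.
pose r : seq ('I_n + 'I_n) := map inr (enum 'I_n) ++ map inl (enum 'I_n).
have ur : uniq r.
  rewrite cat_uniq; apply/and3P; split.
  - by rewrite map_inj_uniq ?enum_uniq// => ? ? [].
  - by apply/hasPn => _ /mapP[j _ ->]; apply/negP => /mapP[].
  - by rewrite map_inj_uniq ?enum_uniq// => ? ? [].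
transitivity (\int[P]_w h (\sum_(i <- r) X i w)%R)%E.
  by apply: eq_integral => w _; rewrite W_IE_sum /h /r big_cat !big_map.
rewrite (@integral_independent_sum _ _ _ P _ X sample_independent (inl (Ordinal n_gt0)))//.
rewrite map_cat iter_exp_cat -!map_comp.
rewrite (@eq_iter_exp _ _
  ((fun i => distribution P (X i) : probability R R) \o inr) (fun=> nu)); last first.
  by move=> j _ A mA; exact: (IE_E_law sampleB).
congr (iter_exp _ _ _); apply/funext => y.
apply: eq_iter_exp => j _ A mA /=.
have [i [iB ji cj]] := cB j.
have iBB : cell B i \in B by rewrite mem_nth.
have [mD D0 _] := gB.1 _ iBB.
rewrite cj cell_law_cond_law// -(IE_V_law sampleB iB ji)//.
by rewrite -[X in measurable X]setTI; exact: measurable_funP.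
Qed.

End SampleRepresentation.

(** * Reduction of the convex order to nonnegative functions *)

Section IntegralOfSum.
Context dT (T : measurableType dT) (R : realType) (mu : {measure set T -> \bar R}).
Local Open Scope ereal_scope.

(** Additivity without integrability of g1. If the integral of g1 is infinite,
so is that of the positive part of the sum, because
g1 <= max (g1 + g2) 0 + max (- g2) 0, while the negative part of the sum is
bounded by that of g2. *)
Lemma integralD_ge0_integrable (g1 g2 : T -> R) :
  measurable_fun setT g1 -> (forall x, 0 <= g1 x)%R ->
  mu.-integrable setT (EFin \o g2) ->
  \int[mu]_x (g1 x + g2 x)%:E = \int[mu]_x (g1 x)%:E + \int[mu]_x (g2 x)%:E.
Proof.
move=> mg1 g10 ig2.
have mg1E : measurable_fun setT (EFin \o g1) by exact/measurable_EFinP.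
have mg2E := measurable_int _ ig2.
have mg2 : measurable_fun setT g2 by exact/measurable_EFinP.
have [g1y|g1y] := eqVneq (\int[mu]_x (g1 x)%:E) +oo; last first.
  have ig1 : mu.-integrable setT (EFin \o g1).
    apply/integrableP; split => //.
    under eq_integral do rewrite /= ger0_norm//.
    by rewrite ltey.
  by under eq_integral do rewrite EFinD; exact: integralD.
have fin2 : \int[mu]_x (g2 x)%:E \is a fin_num by exact: integrable_fin_num.
rewrite g1y addye; last by rewrite gt_eqF// ltNye; case/fin_numP: fin2.
set s : T -> \bar R := fun x => (g1 x + g2 x)%:E.
have ms : measurable_fun setT s by apply/measurable_EFinP; exact: measurable_funD.
have in2 := integrable_funeneg measurableT ig2.
have fn2 : \int[mu]_x ((EFin \o g2)^\- x) < +oo.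
  by have := integrable_fin_num measurableT in2; rewrite ge0_fin_numE//;
    exact: integral_ge0.
rewrite integralE.
have sneg : \int[mu]_x (s^\- x) < +oo.
  apply: le_lt_trans fn2; apply: ge0_le_integral => //.
  - exact: measurable_funeneg.
  - exact: measurable_funeneg.
  move=> x _; rewrite !funenegE /s /= -?EFinN -!EFin_max lee_fin.
  by rewrite ge_max !le_max lerN2 lerDr g10 lexx orbT.
have spos : \int[mu]_x (s^\+ x) = +oo.
  apply/eqP; rewrite -leye_eq.
  have : \int[mu]_x (g1 x)%:E <= \int[mu]_x (s^\+ x) + \int[mu]_x ((EFin \o g2)^\- x).
    rewrite -ge0_integralD//; last 2 first.
    - exact: measurable_funepos.
    - exact: measurable_funeneg.
    apply: ge0_le_integral => //.
    - by move=> x _; rewrite lee_fin.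
    - by apply: emeasurable_funD; [exact: measurable_funepos|exact: measurable_funeneg].
    move=> x _; rewrite funenegE funeposE /s /= -?EFinN -!EFin_max -EFinD lee_fin.
    have : (g1 x + g2 x <= Num.max (g1 x + g2 x) 0)%R by rewrite le_max lexx.
    have : (- g2 x <= Num.max (- g2 x) 0)%R by rewrite le_max lexx.
    by lra.
  rewrite g1y leye_eq; case: (\int[mu]_x (s^\+ x)) => [r| |]//.
    by move=> /eqP ry; move: fn2; rewrite ltey; case: (\int[mu]_x _) ry.
rewrite -/s spos addye//.
by case: (\int[mu]_x s^\- x) sneg.
Qed.

End IntegralOfSum.

Section ConvexOrderReduction.
Context (R : realType) d1 (O1 : measurableType d1) (P : probability O1 R) (Y : O1 -> R).
Context d2 (O2 : measurableType d2) (Q : probability O2 R) (X : O2 -> R).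
Local Open Scope ereal_scope.

(** Subtracting an affine minorant from a convex function leaves a nonnegative
convex function, and changes both expectations by the same finite amount. *)
Lemma le_cx_of_nonneg (M : \bar R) :
  P.-integrable setT (EFin \o Y) -> Q.-integrable setT (EFin \o X) ->
  \int[P]_w (Y w)%:E = M -> \int[Q]_w (X w)%:E = M ->
  (forall psi : R -> R, convex_real psi -> (forall x, 0 <= psi x)%R ->
     \int[P]_w (psi (Y w))%:E <= \int[Q]_w (psi (X w))%:E) ->
  le_cx P Y Q X.
Proof.
move=> iY iX YM XM le_psi; split => // phi /convex_function_real cphi.
have [a [b ab]] := convex_real_minorant cphi.
pose psi x := (phi x - (a * x + b))%R.
have cpsi : convex_real psi by exact: convex_real_subaffine.
have psi0 x : (0 <= psi x)%R by rewrite subr_ge0.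
have split_int d (O : measurableType d) (S : probability O R) (Z : O -> R) :
    S.-integrable setT (EFin \o Z) -> \int[S]_w (Z w)%:E = M ->
    'E_S[phi \o Z] = \int[S]_w (psi (Z w))%:E + (a%:E * M + b%:E).
  move=> iZ ZM; rewrite unlock.
  have mZ : measurable_fun setT Z by apply/measurable_EFinP; exact: measurable_int iZ.
  have icst : S.-integrable setT (EFin \o cst b) by exact: finite_measure_integrable_cst.
  have iaZ : S.-integrable setT (fun w => a%:E * (Z w)%:E) by exact: integrableZl.
  have iaff : S.-integrable setT (EFin \o (fun w => a * Z w + b)%R).
    rewrite (_ : _ \o _ = (fun w => a%:E * (Z w)%:E) \+ (EFin \o cst b))//.
    exact: integrableD.
  have <- : \int[S]_w (a * Z w + b)%:E = a%:E * M + b%:E.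
    rewrite -ZM -integralZl//.
    have <- : \int[S]_w (EFin \o cst b) w = b%:E.
      by rewrite /= integral_cst//= probability_setT mule1.
    by rewrite -integralD.
  rewrite -integralD_ge0_integrable//; last first.
    by apply: measurableT_comp mZ; exact: measurable_convex_real.
  by apply: eq_integral => w _; rewrite /psi subrK.
rewrite (split_int _ _ _ _ iY YM) (split_int _ _ _ _ iX XM).
by rewrite leeD2r// le_psi.
Qed.

End ConvexOrderReduction.

(** * Integrability and mean of the estimator *)

Section SampleMean.
Context (R : realType) (d n : nat) (mu : probability (d.-tuple R) R).
Context (f : {mfun (d.-tuple R) >-> R}) (f0 : d.-tuple R -> R) (nu : probability R R).
Hypothesis ff0 : forall x, cube x -> f x = f0 x.
Hypothesis f01 : forall x, 0 <= f x <= 1.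
Hypothesis n_gt0 : (0 < n)%N.
Context dO (Om : measurableType dO) (P : probability Om R).
Variables (B : seq (set (d.-tuple R))) (Bs : seq {set 'I_n}).
Variables (V : 'I_n -> {RV P >-> d.-tuple R}) (E : 'I_n -> {RV P >-> R}).
Hypothesis B_adm : admissible n mu B.
Hypothesis Bs_assoc : associated mu B Bs.
Hypothesis sampleB : IE_sample mu nu B Bs V E.
Hypothesis nu_int : nu.-integrable setT (EFin : R -> \bar R).
Hypothesis nu_mean : (\int[nu]_x x%:E = 0)%E.
Local Open Scope ereal_scope.

Lemma noise_integrable j : P.-integrable setT (EFin \o E j).
Proof.
apply/integrableP; split; first by apply/measurable_EFinP; exact: measurable_funP.
have /integrableP[_] := nu_int; apply: le_lt_trans.
rewrite [leRHS](eq_measure_integral (distribution P (E j))); last first.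
  by move=> A mA _; exact/esym/(IE_E_law sampleB).
by rewrite ge0_integral_distribution//; exact: measurableT_comp.
Qed.

Lemma noise_mean j : \int[P]_w (E j w)%:E = 0.
Proof.
rewrite -[LHS](@integral_distribution _ _ _ _ _ P (E j) EFin)//; last exact: noise_integrable.
rewrite -nu_mean; apply: eq_measure_integral => A mA _.
exact: (IE_E_law sampleB).
Qed.

Lemma response_integrable j : P.-integrable setT (fun w => (f (V j w))%:E).
Proof.
have mfV : measurable_fun setT (f \o V j) by exact: measurableT_comp.
apply: (@le_integrable _ _ _ _ _ measurableT _ (EFin \o cst 1%R)).
- exact/measurable_EFinP.
- move=> w _ /=; rewrite lee_fin normr1 ger0_norm//.
    by have /andP[] := f01 (V j w).
  by have /andP[] := f01 (V j w).
- exact: finite_measure_integrable_cst.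
Qed.

Lemma response_mean i j : (i < size B)%N -> j \in star Bs i ->
  \int[P]_w (f (V j w))%:E =
  (fine (mu (cell B i)))^-1%:E * \int[mu]_(x in cell B i) (f x)%:E.
Proof.
move=> iB ji.
have gB := admissible_good_cells n_gt0 B_adm.
have [mD D0 _] : [/\ measurable (cell B i), 0 < mu (cell B i) & cell B i `<=` cube].
  by apply: gB.1; rewrite /= mem_nth.
have mh : measurable_fun setT (fun x : R => `|x|%:E) by apply/measurable_EFinP.
have fnorm x : `|f x|%R = f x by rewrite ger0_norm//; have /andP[] := f01 x.
transitivity (\int[distribution P (f \o V j)]_x `|x|%:E).
  rewrite ge0_integral_distribution//.
  by apply: eq_integral => w _ /=; rewrite fnorm.
rewrite (eq_measure_integral (cell_law mu f (cell B i))); last first.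
  move=> A mA _; transitivity (cond_law mu (cell B i) (f @^-1` A)).
    apply: (IE_V_law sampleB iB ji).
    by rewrite -[X in measurable X]setTI; exact: measurable_funP.
  exact/esym/cell_law_cond_law.
rewrite integral_cell_law//; congr (_ * _).
by apply: eq_integral => x _; rewrite fnorm.
Qed.

(** A cell with k points has probability k / n, so its points contribute n times
the integral of f over the cell: the total does not depend on the partition. *)
Lemma response_mean_sum : \sum_(j < n) \int[P]_w (f (V j w))%:E =
  n%:R%:E * \int[mu]_(x in cube) (f x)%:E.
Proof.
have gB := admissible_good_cells n_gt0 B_adm.
have [sB muB _ _] := Bs_assoc; have [mB tB UB _] := B_adm.
rewrite -(big_star Bs_assoc)/= sB.
have mf : measurable_fun setT (EFin \o f) by exact/measurable_EFinP.
have -> : \int[mu]_(x in cube) (f x)%:E =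
    \sum_(i < size B) \int[mu]_(x in cell B i) (f x)%:E.
  rewrite -UB bigcup_mkord -!(big_mkord xpredT).
  rewrite ge0_integral_bigsetU//.
  - by rewrite big_mkord.
  - move=> i; have [iB|iB] := ltnP i (size B); first exact: mB.
    by rewrite /cell nth_default.
  - exact: iota_uniq.
  - move=> i i' /=; rewrite !mem_index_iota => iB iB'; exact: tB.
  - exact: measurable_funTS.
  - by move=> x _; rewrite lee_fin; have /andP[] := f01 x.
have I0 i : 0 <= \int[mu]_(x in cell B i) (f x)%:E.
  by apply: integral_ge0 => x _; rewrite lee_fin; have /andP[] := f01 x.
rewrite ge0_sume_distrr//; apply: eq_bigr => i _.
rewrite (eq_bigr (fun=> (fine (mu (cell B i)))^-1%:E *
    \int[mu]_(x in cell B i) (f x)%:E)); last first.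
  by move=> j ji; exact: response_mean.
have -> (x : \bar R) : \sum_(j in star Bs i) x = #|star Bs i|%:R%:E * x.
  rewrite -sum1_card natr_sum -sumEFin ge0_sume_distrl//.
  by apply: eq_bigr => j _; rewrite mul1e.
rewrite muleA; congr (_ * _).
have [_ D0 _] : [/\ measurable (cell B i), 0 < mu (cell B i) & cell B i `<=` cube].
  by apply: gB.1; rewrite /= mem_nth.
move: D0; rewrite muB// lte_fin /= => D0; rewrite -EFinM; congr (_%:E).
have k0 : (0 < #|star Bs i|%:R :> R)%R by move: D0; rewrite pmulr_lgt0// invr_gt0 ltr0n.
have n0 : (n%:R != 0 :> R)%R by rewrite pnatr_eq0 -lt0n.
by rewrite invf_div mulrC divfK// gt_eqF.
Qed.

Lemma W_IE_integrable_mean :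
  P.-integrable setT (EFin \o W_IE f0 Bs V E) /\
  \int[P]_w (W_IE f0 Bs V E w)%:E = \int[mu]_(x in cube) (f x)%:E.
Proof.
pose S w := \sum_(j <- enum 'I_n) (E j w)%:E + \sum_(j <- enum 'I_n) (f (V j w))%:E.
have WE w : (W_IE f0 Bs V E w)%:E = n%:R^-1%:E * S w.
  by rewrite (W_IE_sum ff0 Bs_assoc sampleB) EFinM EFinD /S !sumEFin.
have iE : P.-integrable setT (fun w => \sum_(j <- enum 'I_n) (E j w)%:E).
  apply: (@integrable_sum _ _ _ _ _ measurableT _ _ _
    (fun j w => (E j w)%:E)) => j _; exact: noise_integrable.
have iV : P.-integrable setT (fun w => \sum_(j <- enum 'I_n) (f (V j w))%:E).
  apply: (@integrable_sum _ _ _ _ _ measurableT _ _ _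
    (fun j w => (f (V j w))%:E)) => j _; exact: response_integrable.
have iS : P.-integrable setT S by exact: integrableD.
split.
  by rewrite (_ : _ \o _ = (fun w => n%:R^-1%:E * S w)); [exact: integrableZl|apply/funext].
under eq_integral do rewrite WE.
rewrite integralZl// integralD//.
rewrite (@integral_sum _ _ _ _ _ measurableT _ (fun j w => (E j w)%:E)); last first.
  by move=> j; exact: noise_integrable.
rewrite (@integral_sum _ _ _ _ _ measurableT _ (fun j w => (f (V j w))%:E)); last first.
  by move=> j; exact: response_integrable.
rewrite big1 ?add0e; last by move=> j _; exact: noise_mean.
rewrite big_enum/= response_mean_sum muleA -EFinM mulVf ?mul1e//.
by rewrite pnatr_eq0 -lt0n.
Qed.

End SampleMean.

(** As the mean is 0, the variance is the second moment, and |X| <= 1 + X^2. *)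
Lemma integrable_finite_variance dO (Om : measurableType dO) (R : realType)
    (P : probability Om R) (X : {RV P >-> R}) :
  ('E_P[X] = 0)%E -> ('V_P[X] < +oo)%E -> P.-integrable setT (EFin \o X).
Proof.
move=> EX; rewrite /variance covariance.unlock EX /= expectation.unlock => VX.
have mX : measurable_fun setT (X : Om -> R) by exact: measurable_funP.
have mX2 : measurable_fun setT (fun w => 1 + X w * X w).
  by apply: measurable_funD => //; exact: measurable_funM.
apply: (@le_integrable _ _ _ _ _ measurableT _ (fun w => (1 + X w * X w)%:E)).
- exact/measurable_EFinP.
- move=> w _ /=; rewrite lee_fin [leRHS]ger0_norm; last by rewrite addr_ge0// -expr2 sqr_ge0.
  have := sqr_ge0 (`|X w| - 1); have : X w * X w = `|X w| * `|X w|.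
    by rewrite -normrM ger0_norm// -expr2 sqr_ge0.
  have := normr_ge0 (X w); move=> h0 -> ; rewrite expr2; move: (`|X w|) h0 => t t0; nra.
apply/integrableP; split; first exact/measurable_EFinP.
under eq_integral.
  move=> w _; rewrite /= ger0_norm; last by rewrite addr_ge0// -expr2 sqr_ge0.
  rewrite EFinD; over.
rewrite ge0_integralD//; last 2 first.
- by move=> w _; rewrite lee_fin -expr2 sqr_ge0.
- by apply/measurable_EFinP; exact: measurable_funM.
have E1 : (\int[P]_w cst 1 w = 1 :> \bar R)%E.
  by rewrite integral_cst//= probability_setT mule1.
apply: lte_add_pinfty; first by rewrite [ltLHS]E1 ltry.
apply: le_lt_trans VX; rewrite le_eqVlt; apply/orP; left; apply/eqP.
by apply: eq_integral => w _ /=; rewrite !fctE /= subr0.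
Qed.

(** * The convex order between the two estimators *)

Theorem theorem4p6 (R : realType) (d n : nat) (hd : (1 <= d)%N) (hn : (1 <= n)%N)
    (dO : measure_display) (Om : measurableType dO) (P : probability Om R)
    (U : {RV P >-> d.-tuple R}) (eps : {RV P >-> R})
    (U_cube : forall w, cube (U w))
    (U_non_atomic : non_atomic (distribution P U))
    (eps_mean : ('E_P[eps] = 0)%E) (eps_var : ('V_P[eps] < +oo)%E)
    (C B : seq (set (d.-tuple R)))
    (C_adm : admissible n (distribution P U) C)
    (B_adm : admissible n (distribution P U) B)
    (C_lattice : forall i, (i < size C)%N -> lattice_set (cell C i))
    (m : nat) (hm : (1 <= m)%N) (CC : nat -> seq (set (d.-tuple R)))
    (CC_first : CC 1%N = C) (CC_last : CC m = B)
    (CC_adm : forall k, (1 <= k <= m)%N ->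
      admissible n (distribution P U) (CC k))
    (CC_refines : forall k, (1 <= k < m)%N -> refines (CC k) (CC k.+1))
    (CC_splits : forall k, (1 <= k < m)%N -> splits (CC k) (CC k.+1))
    (U_MTP2 : MTP2 (distribution P U))
    (f : d.-tuple R -> R)
    (f_meas : measurable_fun cube f)
    (f_range : forall x, cube x -> 0 <= f x <= 1)
    (f_mono : nondecreasing_coord f)
    (Bs Cs : seq {set 'I_n})
    (Bs_assoc : associated (distribution P U) B Bs)
    (Cs_assoc : associated (distribution P U) C Cs)
    (dB : measure_display) (OB : measurableType dB) (PB : probability OB R)
    (VB : 'I_n -> {RV PB >-> d.-tuple R}) (EB : 'I_n -> {RV PB >-> R})
    (sample_B : IE_sample (distribution P U) (distribution P eps) B Bs VB EB)
    (dC : measure_display) (OC : measurableType dC) (PC : probability OC R)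
    (VC : 'I_n -> {RV PC >-> d.-tuple R}) (EC : 'I_n -> {RV PC >-> R})
    (sample_C : IE_sample (distribution P U) (distribution P eps) C Cs VC EC) :
  le_cx PB (W_IE f Bs VB EB) PC (W_IE f Cs VC EC).
Proof.
pose mu : probability (d.-tuple R) R := distribution P U.
pose nu : probability R R := distribution P eps.
have gC := admissible_good_cells hn C_adm.
have mcube : measurable (cube : set (d.-tuple R)).
  have [mC _ <- _] := C_adm.
  by apply: bigcup_measurable => i; exact: mC.
have mF : measurable_fun setT (f \_ cube).
  exact/(measurable_restrictT _ mcube).
pose F : {mfun (d.-tuple R) >-> R} :=
  HB.pack (f \_ cube) (isMeasurableFun.Build _ _ _ _ _ mF).
have FE x : cube x -> F x = f x by move=> cx; rewrite /F /= patchE mem_set.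
have F01 x : 0 <= F x <= 1.
  by rewrite /F /= patchE; case: ifPn => [/set_mem/f_range//|_]; rewrite lexx ler01.
have Fmono : nondecreasing_coord F.
  by move=> j x y cx cy xy xyj; rewrite !FE//; exact: f_mono xy xyj.
have eps_int := integrable_finite_variance eps_mean eps_var.
have nu_int : nu.-integrable setT (EFin : R -> \bar R).
  apply/integrableP; split => //.
  have /integrableP[_] := eps_int; apply: le_lt_trans.
  by rewrite ge0_integral_distribution//; exact: measurableT_comp.
have nu_mean : (\int[nu]_x x%:E = 0)%E.
  rewrite [LHS](@integral_distribution _ _ _ _ _ P eps EFin)//.
  by move: eps_mean; rewrite unlock.
have [iB mB] := W_IE_integrable_mean FE F01 hn B_adm Bs_assoc sample_B nu_int nu_mean.
have [iC mC] := W_IE_integrable_mean FE F01 hn C_adm Cs_assoc sample_C nu_int nu_mean.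
apply: le_cx_of_nonneg iB iC mB mC _ => psi cpsi psi0.
have mpsi := measurable_convex_real cpsi.
have [cB [cBB alB]] := associated_allocation hn B_adm Bs_assoc.
have [cC [cCC alC]] := associated_allocation hn C_adm Cs_assoc.
rewrite (integral_W_IE FE hn B_adm Bs_assoc sample_B cBB mpsi psi0).
rewrite (integral_W_IE FE hn C_adm Cs_assoc sample_C cCC mpsi psi0).
set h := fun y : R => _.
have mh : measurable_fun setT h.
  by apply/measurable_EFinP; apply: measurableT_comp mpsi _; exact: measurable_funM.
have h0 x : (0 <= h x)%E by rewrite lee_fin.
apply: le_iter_exp.
- exact: measurable_iter_exp.
- by move=> x; exact: iter_exp_ge0.
- exact: measurable_iter_exp.
- by move=> x; exact: iter_exp_ge0.
move=> y.
have C_lat D : D \in CC 1%N -> lattice_set D.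
  rewrite CC_first => DC; rewrite -(nth_index set0 DC).
  by apply: C_lattice; rewrite index_mem.
have alB' : allocation n mu [set` CC m] (map cB (enum 'I_n)) by rewrite CC_last.
have F01' x : cube x -> 0 <= F x <= 1 by [].
have [s als le_s] := coarsen_chain hn U_MTP2 Fmono F01' CC_adm CC_splits C_lat
  (ltac:(by rewrite hm leqnn) : (1 <= m <= m)%N) alB'.
have ch : convex_real (fun y => psi (n%:R^-1 * y)).
  have := convex_real_affine n%:R^-1 0 cpsi.
  rewrite (_ : (fun y => psi _) = (fun y => psi (n%:R^-1 * y)))//.
  by apply/funext => z; rewrite addr0.
apply: (le_trans (le_s _ y ch (fun x => psi0 _))).
rewrite CC_first in als.
by rewrite (iter_exp_perm _ _ mh h0 (allocation_perm hn als alC)).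
Qed.
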